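(* Let $n\geq 3$ and consider $S_n(T)$, for a 2-element set $T\subset S_3$, with the uniform probability measure. Let $\mathrm{LIS}_n(\sigma)$ and $\mathrm{LDS}_n(\sigma)$ denote the lengths of the longest increasing and longest decreasing subsequences of $\sigma$. Then: (a) For $T=\{132,321\}$, $\mathrm{LIS}_n$ has the same distribution as $D_n$, and $\mathrm{LDS}_n(\sigma)\leq 2$ for every $\sigma\in S_n(T)$. (b) For $T=\{132,231\}$, $\mathrm{LIS}_n$ and $\mathrm{LDS}_n$ both have the same distribution as $\mathrm{Bin}(n-1,1/2)+1$. (c) For $T=\{132,123\}$, $\mathrm{LDS}_n$ has the same distribution as $T_n$, and $\mathrm{LIS}_n(\sigma)\leq 2$ for every $\sigma\in S_n(T)$. (d) For $T=\{132,213\}$, $\mathrm{LDS}_n$ has the same distribution as $\mathrm{Bin}(n-1,1/2)+1$, and $\mathrm{LIS}_n$ has the same distribution as $R_{n-1}+1$.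
   Context: For a set $T$ of patterns, $S_n(T)$ is the set of permutations of $[n]=\{1,\dots,n\}$ that avoid (i.e., contain no subsequence order-isomorphic to) every pattern in $T$. $\mathrm{Bin}(m,p)$ denotes a binomial random variable. Let $\mathcal{D}[n]=\{(k,m)\in\mathbb{Z}^2:1\leq k<m\leq n\}\cup\{(0,0)\}$ with the uniform probability measure, and define $D_n((k,m))=n-\min(m-k,k)$. Let $X_1,X_2,\dots$ be independent random variables with $P(X_i=1)=P(X_i=0)=1/2$. Define $T_n=n-1-\sum_{i=2}^{n-2}X_i+\sum_{i=2}^{n-1}X_iX_{i-1}$, and let $R_m$ be the length of the longest run of zeros in $X_1,\dots,X_m$. *)

(* Defs.v *)
From HB Require Import structures.
From mathcomp Require Import all_boot all_order all_fingroup all_algebra.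
From mathcomp Require Import finmap.
From mathcomp Require Import all_classical all_reals all_analysis.

Set Implicit Arguments.
Unset Strict Implicit.
Unset Printing Implicit Defensive.

Import Order.TTheory GRing.Theory Num.Theory.
Import numFieldNormedType.Exports.

Local Open Scope classical_set_scope.

(* Permutations of [n] are elements of 'S_n: both positions and values are
   shifted down by one, which affects neither patterns nor monotone
   subsequences. *)

(* The permutation of [k.+1] written w in one-line notation, with values
   1, ..., k.+1. The default value 1%g is returned only when w is not the
   one-line notation of a permutation; see onelineE. *)
Definition oneline (k : nat) (w : seq nat) : 'S_k.+1 :=
  insubd (1%g : 'S_k.+1) [ffun i : 'I_k.+1 => inord (nth 0 w i).-1 : 'I_k.+1].

Lemma onelineE (k : nat) (w : seq nat) (i : 'I_k.+1) :
  perm_eq w (iota 1 k.+1) -> (oneline k w i).+1 = nth 0 w i.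
Proof.
move=> pw; have sw : size w = k.+1 by rewrite (perm_size pw) size_iota.
have uw : uniq w by rewrite (perm_uniq pw) iota_uniq.
have rw (j : 'I_k.+1) : 0 < nth 0 w j <= k.+1.
  have : nth 0 w j \in w by rewrite mem_nth ?sw.
  by rewrite (perm_mem pw) mem_iota add1n ltnS.
have vw (j : 'I_k.+1) : (inord (nth 0 w j).-1 : 'I_k.+1).+1 = nth 0 w j.
  by have /andP[w0 wk] := rw j; rewrite inordK prednK.
have inj : injectiveb [ffun j : 'I_k.+1 => inord (nth 0 w j).-1 : 'I_k.+1].
  apply/injectiveP => a b; rewrite !ffunE => eab.
  apply/val_inj/eqP; rewrite -(nth_uniq 0 _ _ uw) ?sw ?ltn_ord //.
  by rewrite -(vw a) -(vw b) eab.
by rewrite -pvalE /oneline -[pval _]/(val _) insubdK // ffunE vw.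
Qed.

Definition pattern (w : seq nat) : 'S_3 := oneline 2 w.

Definition contains (k n : nat) (s : 'S_n) (p : 'S_k) : bool :=
  [exists f : {ffun 'I_k -> 'I_n},
    [forall i : 'I_k, forall j : 'I_k, (i < j) ==> (f i < f j)] &&
    [forall i : 'I_k, forall j : 'I_k, (s (f i) < s (f j)) == (p i < p j)]].

Definition avoiders (k n : nat) (T : {set 'S_k}) : {set 'S_n} :=
  [set s : 'S_n | [forall p in T, ~~ contains s p]]%SET.

(* A subsequence is given by its set of positions. *)
Definition LIS (n : nat) (s : 'S_n) : nat :=
  \max_(A : {set 'I_n} |
      [forall i : 'I_n in A, forall j : 'I_n in A, (i < j) ==> (s i < s j)]) #|A|.

Definition LDS (n : nat) (s : 'S_n) : nat :=
  \max_(A : {set 'I_n} |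
      [forall i : 'I_n in A, forall j : 'I_n in A, (i < j) ==> (s j < s i)]) #|A|.

Definition Dset (n : nat) : {set 'I_n.+1 * 'I_n.+1} :=
  [set km : 'I_n.+1 * 'I_n.+1 |
    (1 <= km.1 < km.2) || (km == (ord0, ord0))]%SET.

(* No subtraction is truncated on Dset n. *)
Definition Dfun (n : nat) (km : 'I_n.+1 * 'I_n.+1) : nat :=
  n - minn (km.2 - km.1) km.1.

(* The length of the longest block of consecutive zeros x (i+1), ..., x (i+l)
   inside x 1, ..., x m. *)
Definition longest_zero_run (R : realType) (m : nat) (x : nat -> R) : nat :=
  \max_(l < m.+1 |
      [exists i : 'I_m.+1,
        (i + l <= m) && [forall j : 'I_l, x (i + j).+1 == 0%R]]) l.

Local Open Scope ring_scope.

Definition uniform_on (R : realType) (T : finType) (A : {set T})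
    (E : set T) : \bar R :=
  (#|[pred x in A | x \in E]|%:R / #|A|%:R)%:E.

(* Equality of the image laws on the Borel sets of R; mu and nu are only set
   functions so that uniform_on and binomial_prob can be used directly. *)
Definition same_distribution (R : realType) (T U : Type)
    (mu : set T -> \bar R) (f : T -> R) (nu : set U -> \bar R) (g : U -> R) :=
  forall B : set R, measurable B -> mu (f @^-1` B) = nu (g @^-1` B).

Definition mutually_independent (R : realType) (d : measure_display)
    (Omega : measurableType d) (P : probability Omega R)
    (I : set nat) (X : nat -> {RV P >-> R}) : Prop :=
  forall (J : {fset nat}) (B : nat -> set R),
    [set` J] `<=` I -> (forall j, measurable (B j)) ->
    P (\bigcap_(j in [set` J]) (X j @^-1` B j)) =
    (\prod_(j <- J) P (X j @^-1` B j))%E.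

(* The sequence is X_1, X_2, ...: nothing is assumed about X 0. *)
Definition fair_coins (R : realType) (d : measure_display)
    (Omega : measurableType d) (P : probability Omega R)
    (X : nat -> {RV P >-> R}) : Prop :=
  mutually_independent [set i | (1 <= i)%N] X /\
  forall i, (1 <= i)%N ->
    P (X i @^-1` [set 1]) = (1 / 2)%:E /\ P (X i @^-1` [set 0]) = (1 / 2)%:E.

Definition Tvar (R : realType) (n : nat) (x : nat -> R) : R :=
  n%:R - 1 - \sum_(2 <= i < n.-1) x i + \sum_(2 <= i < n) x i * x i.-1.

(* Main.v *)
Require Import Defs.
From HB Require Import structures.
From mathcomp Require Import all_boot all_order all_fingroup all_algebra.
From mathcomp Require Import finmap.
From mathcomp Require Import all_classical all_reals all_analysis.
From mathcomp Require Import measurable_realfun zify ring lra.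

Set Implicit Arguments.
Unset Strict Implicit.
Unset Printing Implicit Defensive.

Import Order.TTheory GRing.Theory Num.Theory.
Import numFieldNormedType.Exports.

(** In each case the avoiders are described by their one-line words.
    (a) If the largest letter is not last, the word is a rotation of the
    increasing word; otherwise remove that letter. This matches the pairs (k, m):
    rotate the first m letters by k.
    (b) The largest letter is first or last, one fair bit per letter: putting it
    last lengthens the increasing subsequences, putting it first the decreasing
    ones.
    (c) At each step the next letter is the largest or the second largest of the
    remaining ones. With bit 0 for "second largest", each maximal run of zeros
    costs exactly one letter to the longest decreasing subsequence, so that
    LDS = n - (number of runs of zeros). A run of zeros starts at 1 if X_1 = 0 and
    at i > 1 if X_i = 0 and X_{i-1} = 1, so there are
    (1 - X_1) + sum_{i=2}^{n-1} (1 - X_i) X_{i-1} of them, which is n - T_n.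
    (d) The word is a decreasing sequence of blocks of consecutive increasing
    letters. With bit 1 for "a new block starts", LDS is the number of blocks and
    LIS the length of the longest block. *)

(** * Monotone subsequences and patterns in words *)

Fixpoint subseqs (w : seq nat) : seq (seq nat) :=
  if w is x :: w' then map (cons x) (subseqs w') ++ subseqs w' else [:: [::]].

Lemma mem_subseqs (t w : seq nat) : (t \in subseqs w) = subseq t w.
Proof.
elim: w t => [|x w IH] t /=; first by rewrite inE; case: t.
rewrite mem_cat IH; case: t => [|y t] /=.
  by rewrite sub0seq orbT.
case: eqP => [->|nyx].
  apply/orP/idP => [[/mapP[u]|]|st].
  - by rewrite IH => su [->].
  - by apply: subseq_trans; rewrite subseq_cons.
  - by left; apply/mapP; exists t; rewrite ?IH.
apply/orP/idP => [[/mapP[u _ [/nyx]]|] //|]; by right.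
Qed.

(** With [ltn] this measures increasing subsequences, with [gtn] decreasing ones, so that both
    statistics share the same recursions. *)
Definition lis (r : rel nat) (w : seq nat) : nat :=
  \max_(t <- subseqs w | pairwise r t) size t.

Lemma leq_lis (r : rel nat) (t w : seq nat) :
  subseq t w -> pairwise r t -> size t <= lis r w.
Proof.
move=> st pt; rewrite /lis; apply: (leq_bigmax_seq (F := fun t => size t)) => //.
by rewrite mem_subseqs.
Qed.

Lemma lis_ex (r : rel nat) (w : seq nat) :
  exists t, [/\ subseq t w, pairwise r t & size t = lis r w].
Proof.
have s0 : [::] \in subseqs w by rewrite mem_subseqs sub0seq.
rewrite /lis; have : forall s : seq (seq nat), {subset s <= subseqs w} ->
    exists t, [/\ subseq t w, pairwise r t
             & size t = \max_(t <- s | pairwise r t) size t].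
  elim=> [_|u s IH us].
    by exists [::]; rewrite big_nil sub0seq.
  have [|t [st pt et]] := IH; first by move=> v vs; apply: us; rewrite inE vs orbT.
  rewrite big_cons; case: ifP => pu; last by exists t.
  case: (leqP (size u) (size t)) => h; last first.
    exists u; rewrite -mem_subseqs us ?mem_head //; split=> //.
    by rewrite -et; apply/esym/maxn_idPl/ltnW.
  by exists t; split=> //; rewrite -et; apply/esym/maxn_idPr.
by apply.
Qed.

Lemma lis_leP (r : rel nat) (w : seq nat) (k : nat) :
  reflect (forall t, subseq t w -> pairwise r t -> size t <= k) (lis r w <= k).
Proof.
apply: (iffP idP) => [lek t st pt|h]; first exact: leq_trans (leq_lis st pt) lek.
by have [t [st pt <-]] := lis_ex r w; apply: h.
Qed.

(** An optimal subsequence either skips [x] or starts with it; in the second case [pairwise r]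
    confines the rest to the letters related to [x]. *)
Lemma lis_cons (r : rel nat) (x : nat) (w : seq nat) :
  lis r (x :: w) = maxn (lis r w) (lis r (seq.filter (r x) w)).+1.
Proof.
apply/eqP; rewrite eqn_leq geq_max; apply/and3P; split.
- apply/lis_leP => -[|y t] //= st /andP[yt pt]; rewrite leq_max.
  move: st; case: eqP => [eyx st|_ st]; last first.
    by rewrite (leq_lis st) //= yt.
  rewrite ltnS orbC leq_lis // subseq_filter st andbT -eyx; exact: yt.
- apply/lis_leP => t st pt; apply: leq_lis => //.
  exact: subseq_trans st (subseq_cons _ _).
- have [t [st pt <-]] := lis_ex r (seq.filter (r x) w).
  move: st; rewrite subseq_filter => /andP[rt st].
  by apply: (@leq_lis r (x :: t)) => /=; rewrite ?eqxx ?rt.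
Qed.

Lemma lis_nil (r : rel nat) : lis r [::] = 0.
Proof. by apply/eqP; rewrite -leqn0; apply/lis_leP => t; rewrite subseq0 => /eqP->. Qed.

Lemma pairwise_rev (T : Type) (r : rel T) (w : seq T) :
  pairwise r (rev w) = pairwise (fun x y => r y x) w.
Proof.
by elim: w => //= x w IH; rewrite rev_cons pairwise_rcons all_rev IH.
Qed.

Lemma lis_rev (r : rel nat) (w : seq nat) :
  lis r (rev w) = lis (fun x y => r y x) w.
Proof.
apply/eqP; rewrite eqn_leq; apply/andP; split; apply/lis_leP => t st pt.
  rewrite -size_rev; apply: leq_lis; rewrite ?pairwise_rev //.
  by rewrite -subseq_rev revK.
by rewrite -size_rev; apply: leq_lis; rewrite ?subseq_rev ?pairwise_rev.
Qed.

Lemma lis_rcons (r : rel nat) (x : nat) (w : seq nat) :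
  lis r (rcons w x) = maxn (lis r w) (lis r (seq.filter (r^~ x) w)).+1.
Proof.
by rewrite -[rcons w x]revK rev_rcons lis_rev lis_cons filter_rev !lis_rev.
Qed.

Lemma lis_cons_all (r : rel nat) (x : nat) (w : seq nat) :
  all (r x) w -> lis r (x :: w) = (lis r w).+1.
Proof. by move=> h; rewrite lis_cons (all_filterP h); lia. Qed.

Lemma lis_rcons_all (r : rel nat) (x : nat) (w : seq nat) :
  all (r^~ x) w -> lis r (rcons w x) = (lis r w).+1.
Proof. by move=> h; rewrite lis_rcons (all_filterP h); lia. Qed.

Lemma filter_none (T : eqType) (p q : pred T) (w : seq T) :
  all q w -> (forall y, q y -> ~~ p y) -> seq.filter p w = [::].
Proof.
move=> /allP h hq; apply/eqP; rewrite -[_ == _]negbK -has_filter.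
by apply/hasPn => y /h/hq.
Qed.

(** A subsequence that is pairwise related cannot meet both factors, so it lies in one of them. *)
Lemma lis_cat_none (r : rel nat) (u w : seq nat) :
  (forall x y, x \in u -> y \in w -> ~~ r x y) ->
  lis r (u ++ w) = maxn (lis r u) (lis r w).
Proof.
move=> h; apply/eqP; rewrite eqn_leq geq_max; apply/and3P; split.
- apply/lis_leP => t; rewrite leq_max.
  case/subseqP => m; rewrite size_cat => sm ->.
  (* Cutting the selection mask at [size u] separates the letters taken from [u] from those taken
     from [w]. *)
  rewrite -[m](cat_take_drop (size u)) mask_cat; last first.
    by rewrite size_takel // sm leq_addr.
  set t1 := mask _ u; set t2 := mask _ w => pt.
  have s1 : subseq t1 u by apply: mask_subseq.
  have s2 : subseq t2 w by apply: mask_subseq.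
  move: t1 t2 s1 s2 pt => [|x t1] t2 s1 s2.
    by move=> pt; rewrite (leq_lis s2) ?orbT.
  case: t2 s2 => [|y t2] s2; first by rewrite cats0 => pt; rewrite (leq_lis s1).
  rewrite pairwise_cat => /and3P[/allrelP rt _ _].
  have := h x y; rewrite (mem_subseq s1) ?mem_head // (mem_subseq s2) ?mem_head //.
  by rewrite rt ?mem_head // => /(_ isT isT).
- apply/lis_leP => t st pt; apply: leq_lis => //.
  exact: subseq_trans st (prefix_subseq _ _).
- apply/lis_leP => t st pt; apply: leq_lis => //.
  exact: subseq_trans st (suffix_subseq _ _).
Qed.

Lemma lis_pairwise (r : rel nat) (w : seq nat) : pairwise r w -> lis r w = size w.
Proof.
move=> pw; apply/eqP; rewrite eqn_leq leq_lis // andbT.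
by apply/lis_leP => t st _; apply: size_subseq.
Qed.

(* Three comparisons suffice only for pairwise distinct a, b, c. *)
Definition order_iso3 (p : nat * nat * nat) (a b c : nat) : bool :=
  let: (x, y, z) := p in
  [&& (a < b) == (x < y), (a < c) == (x < z) & (b < c) == (y < z)].

Definition avoids (p : nat * nat * nat) (w : seq nat) : Prop :=
  forall a b c, subseq [:: a; b; c] w -> ~~ order_iso3 p a b c.

Lemma avoids_subseq p (v w : seq nat) : subseq v w -> avoids p w -> avoids p v.
Proof. by move=> vw aw a b c sv; apply: aw; apply: subseq_trans sv vw. Qed.

Lemma avoids_cons p x (w : seq nat) :
  avoids p w -> (forall b c, subseq [:: b; c] w -> ~~ order_iso3 p x b c) ->
  avoids p (x :: w).
Proof.
move=> aw h a b c; rewrite [subseq _ _]/=.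
by case: (a =P x) => [-> /h|_ /aw].
Qed.

Lemma subseq_rcons2 (T : eqType) (t w : seq T) (x y : T) :
  subseq (rcons t y) (rcons w x) -> (y = x /\ subseq t w) \/ subseq (rcons t y) w.
Proof.
rewrite -subseq_rev !rev_rcons /=; case: eqP => [-> h|_ h].
  by left; split=> //; rewrite -subseq_rev.
by right; rewrite -subseq_rev rev_rcons.
Qed.

Lemma avoids_rcons p x (w : seq nat) :
  avoids p w -> (forall a b, subseq [:: a; b] w -> ~~ order_iso3 p a b x) ->
  avoids p (rcons w x).
Proof.
move=> aw h a b c /(@subseq_rcons2 _ [:: a; b] w x c)[[-> /h]|/aw] //.
Qed.

Lemma subseq2_mem (T : eqType) (a b : T) w : subseq [:: a; b] w -> a \in w /\ b \in w.
Proof. by move=> /mem_subseq s; split; apply: s; rewrite !inE eqxx ?orbT. Qed.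

Lemma subseq3_uniq (T : eqType) (a b c : T) w : uniq w ->
  subseq [:: a; b; c] w -> [/\ a != b, a != c & b != c].
Proof.
by move=> uw /subseq_uniq/(_ uw); rewrite /= !inE negb_or andbT => /andP[/andP[]].
Qed.

Lemma subseq2_uniq (T : eqType) (a b : T) w : uniq w -> subseq [:: a; b] w -> a != b.
Proof. by move=> uw /subseq_uniq/(_ uw); rewrite /= !inE andbT. Qed.

Lemma subseq_pair (T : eqType) (a b : T) w :
  a != b -> a \in w -> b \in w -> subseq [:: a; b] w \/ subseq [:: b; a] w.
Proof.
move=> nab; case/splitPr => w1 w2; rewrite mem_cat inE eq_sym (negPf nab) /=.
case/orP => h; [right|left].
  by apply: (@cat_subseq _ [:: b] [:: a]); rewrite sub1seq // mem_head.
rewrite -[_ :: _]cat0s; apply: cat_subseq; first exact: sub0seq.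
by rewrite /= eqxx sub1seq.
Qed.

Lemma subseq2_cat (T : eqType) (a b : T) u v : subseq [:: a; b] (u ++ v) ->
  subseq [:: a; b] u \/ (a \in u /\ b \in v) \/ subseq [:: a; b] v.
Proof.
elim: u => [|x u IH]; first by right; right.
rewrite cat_cons /= inE; case: eqP => [_|_ /IH] //=.
by rewrite !sub1seq mem_cat => /orP[]; [left|right; left].
Qed.

Lemma pairwise_subseq2 (T : eqType) (r : rel T) (w : seq T) :
  reflect (forall a b, subseq [:: a; b] w -> r a b) (pairwise r w).
Proof.
apply: (iffP idP) => [pw a b /subseq_pairwise/(_ pw) /=|]; first by rewrite !andbT.
elim: w => //= x w IH h; rewrite IH ?andbT; last first.
  move=> a b s; apply: h; case: eqP => // _.
  by apply: subseq_trans s; exact: subseq_cons.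
by apply/allP => y yw; apply: h; rewrite eqxx sub1seq.
Qed.

(** * Bit strings and their counts *)

Fixpoint allbits (m : nat) : seq (seq bool) :=
  if m is m'.+1 then map (cons true) (allbits m') ++ map (cons false) (allbits m')
  else [:: [::]].

Lemma mem_allbits m bs : (bs \in allbits m) = (size bs == m).
Proof.
elim: m bs => [|m IH] bs /=; first by rewrite inE; case: bs.
rewrite mem_cat; case: bs => [|x bs] /=.
  by apply/negP => /orP[] /mapP[].
rewrite eqSS -IH; apply/orP/idP => [[] /mapP[u ? [_ ->]] //|h].
by case: x; [left|right]; apply/mapP; exists bs.
Qed.

Lemma allbits_uniq m : uniq (allbits m).
Proof.
elim: m => //= m IH; rewrite cat_uniq !map_inj_uniq ?IH /=; try by move=> ? ? [].
by rewrite andbT; apply/hasPn => bs /mapP[u _ ->]; apply/negP => /mapP[].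
Qed.

Lemma size_allbits m : size (allbits m) = 2 ^ m.
Proof. by elim: m => //= m IH; rewrite size_cat !size_map IH expnS mul2n addnn. Qed.

Lemma count_allbits m k :
  count (fun bs => count id bs == k) (allbits m) = 'C(m, k).
Proof.
elim: m k => [|m IH] [|k] //=; rewrite count_cat !count_map.
  rewrite (eq_count (a2 := pred0)) // count_pred0 add0n bin0 -(bin0 m) -IH.
  by apply: eq_count.
rewrite binS -!IH addnC; congr (_ + _); exact: eq_count.
Qed.

(** Flipping every bit swaps the two halves of [allbits]; this lets a count of zeros use the
    binomial law of the count of ones. *)
Lemma count_allbits_negb m (p : pred nat) :
  count (fun bs => p (count negb bs)) (allbits m) =
  count (fun bs => p (count id bs)) (allbits m).
Proof.
elim: m p => //= m IH p; rewrite !count_cat !count_map addnC.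
congr (_ + _); [exact: (IH (fun k => p k.+1))|exact: (IH p)].
Qed.

(** * Words avoiding 132 and 321 *)

(** The rotation index starts at 1: the trivial rotation ends with the largest letter and already
    belongs to the first list. *)
Fixpoint rotation_words (n : nat) : seq (seq nat) :=
  if n is n'.+1 then
    [seq rcons w n' | w <- rotation_words n'] ++
    [seq rot j (iota 0 n) | j <- iota 1 n']
  else [:: [::]].

(** The pairs are listed in the order of [rotation_words], so that the two statistics agree entry by
    entry. *)
Fixpoint pairs_below (n : nat) : seq (nat * nat) :=
  if n is n'.+1 then pairs_below n' ++ [seq (k, n) | k <- iota 1 n']
  else [:: (0, 0)].

Lemma mem_pairs_below n k m :
  ((k, m) \in pairs_below n) = (1 <= k < m) && (m <= n) || ((k, m) == (0, 0)).
Proof.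
elim: n => [|n IH] /=; first by rewrite inE; case: eqP; lia.
rewrite mem_cat {}IH.
have -> : ((k, m) \in [seq (i, n.+1) | i <- iota 1 n]) = (1 <= k < n.+1) && (m == n.+1).
  apply/mapP/idP => [[i + [-> ->]]|/andP[hk /eqP ->]]; first by rewrite mem_iota; lia.
  by exists k; rewrite // mem_iota; lia.
by case: eqP => ?; lia.
Qed.

Lemma pairs_below_uniq n : uniq (pairs_below n).
Proof.
elim: n => //= n IH; rewrite cat_uniq IH map_inj_uniq ?iota_uniq ?andbT /=.
  apply/hasPn => _ /mapP[k _ ->]; rewrite mem_pairs_below xpair_eqE; lia.
by move=> ? ? [].
Qed.

Lemma rot_iota j n : j <= n -> rot j (iota 0 n) = iota j (n - j) ++ iota 0 j.
Proof. by move=> le; rewrite /rot drop_iota take_iota add0n (minn_idPl le). Qed.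

Lemma pairwise_ltn_iota m n : pairwise ltn (iota m n).
Proof. by rewrite -sorted_pairwise ?iota_ltn_sorted //; exact: ltn_trans. Qed.

Lemma perm_rotation_words n w : w \in rotation_words n -> perm_eq w (iota 0 n).
Proof.
elim: n w => [|n IH] w; first by rewrite inE => /eqP ->.
rewrite mem_cat => /orP[/mapP[v /IH pv ->]|/mapP[j _ ->]]; last by rewrite perm_rot.
by rewrite -addn1 iotaD /= cats1 add0n -!cats1 perm_cat2r.
Qed.

(** Descents only go from [u] to [v]. A 321 would need two of them in succession; in a 132 the
    descent puts the last letter in [v] and the first in [u], hence the last below the first. *)
Lemma avoids_increasing_cat u v : pairwise ltn u -> pairwise ltn v ->
  allrel gtn u v -> avoids (1, 3, 2) (u ++ v) /\ avoids (3, 2, 1) (u ++ v).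
Proof.
move=> pu pv /allrelP uv.
have h x y : subseq [:: x; y] (u ++ v) ->
    [\/ x < y /\ x \in u /\ y \in u, x < y /\ x \in v /\ y \in v
     | y < x /\ x \in u /\ y \in v].
  case/subseq2_cat => [s|[[hx hy]|s]].
  - constructor 1; split; last exact: subseq2_mem.
    by have /andP[] := subseq_pairwise s pu; rewrite /= andbT.
  - by constructor 3; split=> //; apply: uv.
  - constructor 2; split; last exact: subseq2_mem.
    by have /andP[] := subseq_pairwise s pv; rewrite /= andbT.
have sub2 a b c : subseq [:: a; b; c] (u ++ v) ->
    subseq [:: a; b] (u ++ v) /\ subseq [:: b; c] (u ++ v).
  move=> s; split; apply: subseq_trans s.
    by rewrite -[[:: a; b; c]]/([:: a; b] ++ [:: c]) prefix_subseq.
  exact: subseq_cons.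
split=> a b c /sub2[/h hab /h hbc] /=.
  case: hbc => [[? _]|[? _]|[? [bu cv]]]; try lia.
  case: hab => [[? [au _]]|[? [_ bv]]|[? [_ bv]]].
  - by have /= := uv _ _ au cv; lia.
  - by have /= := uv _ _ bu bv; lia.
  - by have /= := uv _ _ bu bv; lia.
case: hbc => [[? _]|[? _]|[? [bu cv]]]; try lia.
case: hab => [[? _]|[? _]|[? [_ bv]]]; try lia.
by have /= := uv _ _ bu bv; lia.
Qed.

Lemma avoids_rotation_words n w : w \in rotation_words n ->
  avoids (1, 3, 2) w /\ avoids (3, 2, 1) w.
Proof.
elim: n w => [|n IH] w.
  by rewrite inE => /eqP ->; split=> ? ? ? /size_subseq.
rewrite mem_cat => /orP[/mapP[v vn ->]|/mapP[j jn ->]].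
  have lt x : x \in v -> x < n.
    by rewrite (perm_mem (perm_rotation_words vn)) mem_iota.
  have [av1 av2] := IH v vn.
  by split; apply: avoids_rcons => // a b /subseq2_mem[/lt ha /lt hb] /=; lia.
move: jn; rewrite mem_iota => jn; rewrite rot_iota; last by lia.
apply: avoids_increasing_cat; rewrite ?pairwise_ltn_iota //.
by apply/allrelP => x y; rewrite !mem_iota /=; lia.
Qed.

(** Write the word as [u], [n], [v]. If [v] is empty, induction applies. Otherwise a letter of [u]
    below one of [v] would form 132 with [n], a descent in [u] would form 321 with a letter of [v],
    and a descent in [v] would form 321 with [n]. *)
Lemma rotation_words_surj n w : perm_eq w (iota 0 n) ->
  avoids (1, 3, 2) w -> avoids (3, 2, 1) w -> w \in rotation_words n.
Proof.
elim: n w => [|n IH] w pw av1 av2.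
  by rewrite inE -size_eq0 (perm_size pw).
have uw : uniq w by rewrite (perm_uniq pw) iota_uniq.
have nw : n \in w by rewrite (perm_mem pw) mem_iota; lia.
case/splitPr: nw pw av1 av2 uw => u v pw av1 av2 uw.
have pw' : perm_eq (u ++ v) (iota 0 n).
  move: pw; rewrite -(cat1s n v) perm_catCA -addn1 iotaD add0n /=.
  by rewrite perm_sym perm_catC /= perm_cons perm_sym.
have lt x : x \in u ++ v -> x < n by rewrite (perm_mem pw') mem_iota.
rewrite mem_cat; case: v => [|y v] in pw av1 av2 uw pw' lt *.
  rewrite cats0 in pw' lt; rewrite cats1.
  apply/orP; left; apply/mapP; exists u => //; apply: IH => //.
    exact: avoids_subseq (prefix_subseq _ _) av1.
  exact: avoids_subseq (prefix_subseq _ _) av2.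
apply/orP; right; set v' := y :: v in pw av1 av2 uw pw' lt *.
have uv_gt a c : a \in u -> c \in v' -> c < a.
  move=> au cv; have ss : subseq [:: a; n; c] (u ++ n :: v').
    apply: (@cat_subseq _ [:: a] [:: n; c]); first by rewrite sub1seq.
    by apply: (@cat_subseq _ [:: n] [:: c] [:: n] v'); rewrite ?sub1seq ?mem_head.
  have [_ nac _] := subseq3_uniq uw ss.
  have := av1 _ _ _ ss; have := lt a; have := lt c.
  by rewrite !mem_cat au cv ?orbT /= => /(_ isT) + /(_ isT); lia.
have pu : pairwise ltn u.
  apply/pairwise_subseq2 => a b s.
  have ss : subseq [:: a; b; y] (u ++ n :: v').
    apply: (@cat_subseq _ [:: a; b] [:: y]) => //.
    by rewrite sub1seq !inE eqxx orbT.
  have [nab _ _] := subseq3_uniq uw ss; have [au bu] := subseq2_mem s.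
  have := av2 _ _ _ ss; have := uv_gt a y au (mem_head _ _).
  by have := uv_gt b y bu (mem_head _ _); rewrite /=; lia.
have pv : pairwise ltn v'.
  apply/pairwise_subseq2 => a b s.
  have ss : subseq [:: n; a; b] (u ++ n :: v').
    apply: (@cat_subseq _ [::] [:: n; a; b]); rewrite ?sub0seq //.
    exact: (@cat_subseq _ [:: n] [:: a; b] [:: n] v').
  have [_ _ nab] := subseq3_uniq uw ss; have [au bu] := subseq2_mem s.
  have := av2 _ _ _ ss; have := lt a; have := lt b.
  by rewrite !mem_cat au bu ?orbT /= => /(_ isT) + /(_ isT); lia.
(* Moving [v'] to the front yields a sorted word, so the original is the increasing word rotated by
   [size v']. *)
have e : v' ++ rcons u n = iota 0 n.+1.
  apply: (irr_sorted_eq ltn_trans ltnn); rewrite ?iota_ltn_sorted //; last first.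
    move=> z; rewrite -(perm_mem pw) -cats1 !mem_cat !inE orbC.
    by rewrite -!orbA; case: (z \in u); rewrite ?orbT.
  rewrite sorted_pairwise; last exact: ltn_trans.
  rewrite pairwise_cat pv pairwise_rcons pu !andbT; apply/andP; split.
    apply/allrelP => a b av; rewrite mem_rcons inE => /orP[/eqP ->|bu] /=.
      by apply: lt; rewrite mem_cat av orbT.
    exact: uv_gt.
  by apply/allP => z zu; apply: lt; rewrite mem_cat zu.
apply/mapP; exists (size v'); last by rewrite -e rot_size_cat -cats1 -catA.
have := congr1 size e; rewrite size_cat size_rcons size_iota mem_iota /=; lia.
Qed.

(** The last letter separates the two lists, since a rotation by [j] ends with [j - 1]; the first
    letter [j] separates the rotations. *)
Lemma rotation_words_uniq n : uniq (rotation_words n).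
Proof.
elim: n => // n IH; rewrite cat_uniq map_inj_uniq ?IH; last first.
  by move=> u v /rcons_inj [].
apply/and3P; split=> //.
  apply/hasPn => _ /mapP[j jn ->]; apply/negP => /mapP[v _].
  move: jn; rewrite mem_iota => jn; rewrite rot_iota; last by lia.
  move/(congr1 (last 0)); rewrite last_rcons last_cat.
  by case: j jn => // j jn; rewrite -addn1 iotaD last_cat /=; lia.
rewrite map_inj_in_uniq ?iota_uniq // => i j; rewrite !mem_iota => hi hj.
rewrite !rot_iota; try lia.
have -> : n.+1 - i = (n - i).+1 by lia.
have -> : n.+1 - j = (n - j).+1 by lia.
by move/(congr1 (head 0)).
Qed.

(** A final largest letter adds one to both sides. A rotation consists of two increasing blocks with
    no ascent across, so the longer block counts, and its length is the total minus the shorter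
    one. *)
Lemma lis_rotation_words n :
  map (lis ltn) (rotation_words n) =
  [seq n - minn (km.2 - km.1) km.1 | km <- pairs_below n].
Proof.
elim: n => [|n IH]; first by rewrite /= lis_nil.
rewrite !map_cat -!map_comp; congr (_ ++ _).
  transitivity (map succn (map (lis ltn) (rotation_words n))).
    rewrite -map_comp; apply/eq_in_map => w /perm_rotation_words pw /=.
    rewrite lis_rcons_all // (perm_all _ pw).
    by apply/allP => x; rewrite mem_iota.
  rewrite IH -map_comp; apply/eq_in_map => -[k m]; rewrite mem_pairs_below /=.
  by case: eqP => [[-> ->]|_] //; lia.
apply/eq_in_map => j; rewrite mem_iota /= => hj.
rewrite -[0 :: _]/(iota 0 n.+1) rot_iota; last by lia.
rewrite lis_cat_none; last by move=> x y; rewrite !mem_iota /=; lia.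
by rewrite !lis_pairwise ?pairwise_ltn_iota // !size_iota; lia.
Qed.

(** * Words avoiding 132 and 231 *)

(* The letters are a :: l in decreasing order and size bs = size l; the bit read
   with a tells whether a is last (true) or first (false). *)
Fixpoint ends_word (a : nat) (l : seq nat) (bs : seq bool) : seq nat :=
  match l, bs with
  | b :: l', x :: bs' =>
      if x then rcons (ends_word b l' bs') a else a :: ends_word b l' bs'
  | _, _ => [:: a]
  end.

Lemma ends_word_perm a l bs :
  size bs = size l -> perm_eq (ends_word a l bs) (a :: l).
Proof.
elim: l a bs => [|b l IH] a [|x bs] //= [sz].
case: x; last by rewrite perm_cons IH.
by rewrite perm_rcons perm_cons IH.
Qed.

Lemma ends_word_lt a b l bs : pairwise gtn [:: a, b & l] -> size bs = size l ->
  all (gtn a) (ends_word b l bs).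
Proof. by move=> /andP[al _] sz; rewrite (perm_all _ (ends_word_perm _ sz)). Qed.

Lemma ends_word_neq0 a l bs : ends_word a l bs != [::].
Proof.
by case: l bs => [|b l] [|[] bs] //=; rewrite -size_eq0 size_rcons.
Qed.

Lemma lis_ends_word a l bs : pairwise gtn (a :: l) -> size bs = size l ->
  lis ltn (ends_word a l bs) = (count id bs).+1.
Proof.
elim: l a bs => [|b l IH] a [|x bs] // dl sz.
  by rewrite /= lis_cons /= !lis_nil.
have dl' : pairwise gtn (b :: l) by case/andP: dl.
case: sz => sz; have lt := ends_word_lt dl sz; rewrite /=.
case: x; first by rewrite lis_rcons_all ?IH.
rewrite lis_cons (filter_none lt) ?IH ?lis_nil //.
by move=> y /=; lia.
Qed.

Lemma lds_ends_word a l bs : pairwise gtn (a :: l) -> size bs = size l ->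
  lis gtn (ends_word a l bs) = (count negb bs).+1.
Proof.
elim: l a bs => [|b l IH] a [|x bs] // dl sz.
  by rewrite /= lis_cons /= !lis_nil.
have dl' : pairwise gtn (b :: l) by case/andP: dl.
case: sz => sz; have lt := ends_word_lt dl sz; rewrite /=.
case: x; last by rewrite lis_cons_all ?IH.
rewrite lis_rcons (filter_none lt) ?IH ?lis_nil //.
by move=> y /=; lia.
Qed.

(** The 3 of both patterns is in the middle, whereas each added largest letter is at an end. *)
Lemma avoids_ends_word a l bs : pairwise gtn (a :: l) -> size bs = size l ->
  avoids (1, 3, 2) (ends_word a l bs) /\ avoids (2, 3, 1) (ends_word a l bs).
Proof.
elim: l a bs => [|b l IH] a [|x bs] // dl sz.
  by split=> ? ? ? /size_subseq.
have dl' : pairwise gtn (b :: l) by case/andP: dl.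
case: sz => sz; have /allP lt := ends_word_lt dl sz.
have [av1 av2] := IH b bs dl' sz; rewrite /=.
case: x; split; (apply: avoids_rcons || apply: avoids_cons) => // u v;
  by case/subseq2_mem => /lt /= hu /lt /= hv; lia.
Qed.

Lemma ends_word_surj a l w : pairwise gtn (a :: l) -> perm_eq w (a :: l) ->
  avoids (1, 3, 2) w -> avoids (2, 3, 1) w ->
  exists2 bs, size bs = size l & w = ends_word a l bs.
Proof.
elim: l a w => [|b l IH] a w dl pw av1 av2.
  by exists [::] => //; apply/perm_small_eq.
have dl' : pairwise gtn (b :: l) by case/andP: dl.
have /allP lt : all (gtn a) (b :: l) by case/andP: dl.
have uw : uniq w.
  by rewrite (perm_uniq pw) (pairwise_uniq _ dl) // => x /=; rewrite ltnn.
have aw : a \in w by rewrite (perm_mem pw) mem_head.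
case/splitPr: aw pw av1 av2 uw => w1 w2 pw av1 av2 uw.
have pw' : perm_eq (w1 ++ w2) (b :: l).
  by move: pw; rewrite -cat1s perm_catCA perm_cons.
have sub : subseq (w1 ++ w2) (w1 ++ a :: w2).
  by rewrite cat_subseq // subseq_cons.
have [bs sz e] := IH b (w1 ++ w2) dl' pw' (avoids_subseq sub av1) (avoids_subseq sub av2).
case: w1 => [|x w1] in pw av1 av2 uw pw' sub e *.
  by exists (false :: bs); [rewrite /= sz|rewrite /= -e].
case: w2 => [|y w2] in pw av1 av2 uw pw' sub e *.
  by exists (true :: bs); [rewrite /= sz|rewrite /= -e cats0 cats1].
(* Letters on both sides of the maximum [a] form 132 or 231, according to which of them is
   smaller. *)
have ss : subseq [:: x; a; y] ((x :: w1) ++ a :: y :: w2).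
  apply: (@cat_subseq _ [:: x] [:: a; y]); first by rewrite sub1seq mem_head.
  by rewrite /= !eqxx sub0seq.
have hx : x < a by apply: lt; rewrite -(perm_mem pw') mem_head.
have hy : y < a by apply: lt; rewrite -(perm_mem pw') mem_cat mem_head orbT.
have [_ nxy _] := subseq3_uniq uw ss.
have := av1 _ _ _ ss; have := av2 _ _ _ ss; rewrite /=; lia.
Qed.

Lemma ends_word_inj a l bs1 bs2 : pairwise gtn (a :: l) ->
  size bs1 = size l -> size bs2 = size l ->
  ends_word a l bs1 = ends_word a l bs2 -> bs1 = bs2.
Proof.
elim: l a bs1 bs2 => [|b l IH] a [|x bs1] [|y bs2] // dl sz1 sz2.
have dl' : pairwise gtn (b :: l) by case/andP: dl.
(* If [a] were also the first letter, it would belong to the inner word, whose letters are all below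
   [a]. *)
have neq u v w : size w = size l -> rcons (ends_word b l w) u = a :: v -> False.
  move=> sz; have := ends_word_lt dl sz; have := ends_word_neq0 b l w.
  by case: ends_word => // z s _ /= /andP[+ _] [ez _]; rewrite ez ltnn.
case: sz1 sz2 => sz1 [sz2] /=; case: x y => -[].
- by move/rcons_inj => [/(IH _ _ _ dl' sz1 sz2) ->].
- by move/neq => /(_ sz1).
- by move/esym/neq => /(_ sz2).
- by move=> [/(IH _ _ _ dl' sz1 sz2) ->].
Qed.

(** * Words avoiding 132 and 123 *)

(* The letters are a :: l in decreasing order and size bs = size l. *)
Fixpoint top2_word (a : nat) (l : seq nat) (bs : seq bool) : seq nat :=
  match l, bs with
  | b :: l', x :: bs' =>
      if x then a :: top2_word b l' bs' else b :: top2_word a l' bs'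
  | _, _ => [:: a]
  end.

(** Each run of zeros is counted at its start, where a one precedes a zero; [prev] is the preceding
    bit, and the value [true] lets an initial zero start a run. *)
Fixpoint zero_runs (prev : bool) (bs : seq bool) : nat :=
  if bs is x :: bs' then (prev && ~~ x) + zero_runs x bs' else 0.

Lemma top2_word_perm a l bs :
  size bs = size l -> perm_eq (top2_word a l bs) (a :: l).
Proof.
elim: l a bs => [|b l IH] a [|x bs] //= [sz].
case: x; first by rewrite perm_cons IH.
by rewrite -(cat1s a) -(cat1s b l) perm_sym perm_catCA perm_cons perm_sym IH.
Qed.

Lemma pairwise_gtn_skip a b l :
  pairwise gtn [:: a, b & l] -> pairwise gtn (a :: l).
Proof. by move=> /= /and3P[/andP[_ ->] _ ->]. Qed.

Lemma zero_runs_le bs : zero_runs false bs <= zero_runs true bs.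
Proof. by case: bs => //= x bs; lia. Qed.

(* Once the second largest letter has been taken, the largest one is useless for
   decreasing subsequences, whence the second component. *)
Lemma lds_top2_word_strong a l bs : pairwise gtn (a :: l) -> size bs = size l ->
  lis gtn (top2_word a l bs) + zero_runs true bs = (size l).+1 /\
  lis gtn (seq.filter (gtn a) (top2_word a l bs)) + zero_runs false bs = size l.
Proof.
elim: l a bs => [|b l IH] a [|x bs] // dl sz.
  by rewrite /= ltnn lis_cons /= !lis_nil.
have dl' : pairwise gtn (b :: l) by case/andP: dl.
have dl'' := pairwise_gtn_skip dl.
have ba : b < a by move: dl => /= /andP[/andP[]].
have bl : all (gtn b) l by case/andP: dl'.
case: sz => sz; case: x => /=.
  have lt : all (gtn a) (top2_word b l bs).
    by rewrite (perm_all _ (top2_word_perm _ sz)); case/andP: dl.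
  have [h _] := IH b bs dl' sz.
  by rewrite ltnn (all_filterP lt) lis_cons_all //; lia.
have [h1 h2] := IH a bs dl'' sz.
(* Apart from [a] itself, all letters of this word are below [b], so both filters remove exactly
   [a]. *)
have e : seq.filter (gtn b) (top2_word a l bs) = seq.filter (gtn a) (top2_word a l bs).
  apply: eq_in_filter => z; rewrite (perm_mem (top2_word_perm _ sz)) inE.
  by case/orP => [/eqP ->|/(allP bl)] /=; lia.
have lt : all (gtn b) (seq.filter (gtn a) (top2_word a l bs)).
  by rewrite -e filter_all.
(* Taking [b] is at least as good as skipping it: skipping keeps [a] available, but by [h1], [h2]
   and [zero_runs_le] this gains at most the one letter lost. *)
rewrite ba lis_cons e (lis_cons_all lt); have := zero_runs_le bs; lia.
Qed.

Lemma lds_top2_word a l bs : pairwise gtn (a :: l) -> size bs = size l ->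
  lis gtn (top2_word a l bs) + zero_runs true bs = (size l).+1.
Proof. by move=> dl sz; case: (lds_top2_word_strong dl sz). Qed.

(** The first letter would play the 1 of either pattern and need two larger letters after it; at
    most one remains. *)
Lemma avoids_top2_word a l bs : pairwise gtn (a :: l) -> size bs = size l ->
  avoids (1, 3, 2) (top2_word a l bs) /\ avoids (1, 2, 3) (top2_word a l bs).
Proof.
elim: l a bs => [|b l IH] a [|x bs] // dl sz.
  by split=> ? ? ? /size_subseq.
have dl' : pairwise gtn (b :: l) by case/andP: dl.
have dl'' := pairwise_gtn_skip dl.
have al : all (gtn a) (b :: l) by case/andP: dl.
have bl : all (gtn b) l by case/andP: dl'.
have irr : irreflexive gtn by move=> z /=; rewrite ltnn.
case: sz => sz; case: x => /=.
  have [av1 av2] := IH b bs dl' sz.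
  have h u v : subseq [:: u; v] (top2_word b l bs) -> u < a /\ v < a.
    case/subseq2_mem; rewrite !(perm_mem (top2_word_perm _ sz)).
    by move=> /(allP al) /= -> /(allP al) /= ->.
  by split; apply: avoids_cons => // u v /h [hu hv] /=; lia.
have [av1 av2] := IH a bs dl'' sz.
have h u v : subseq [:: u; v] (top2_word a l bs) -> u < b \/ v < b.
  move=> ss; have uw : uniq (top2_word a l bs).
    by rewrite (perm_uniq (top2_word_perm _ sz)) (pairwise_uniq irr).
  have := subseq2_uniq uw ss; case/subseq2_mem: ss.
  rewrite !(perm_mem (top2_word_perm _ sz)) !inE.
  case/orP => [/eqP ->|/(allP bl)]; last by left.
  by case/orP => [/eqP ->|/(allP bl)]; [rewrite eqxx|right].
by split; apply: avoids_cons => // u v /h [hu|hv] /=; lia.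
Qed.

Lemma top2_word_surj a l w : pairwise gtn (a :: l) -> perm_eq w (a :: l) ->
  avoids (1, 3, 2) w -> avoids (1, 2, 3) w ->
  exists2 bs, size bs = size l & w = top2_word a l bs.
Proof.
elim: l a w => [|b l IH] a w dl pw av1 av2.
  by exists [::] => //; apply/perm_small_eq.
have dl' : pairwise gtn (b :: l) by case/andP: dl.
have dl'' := pairwise_gtn_skip dl.
have ba : b < a by move: dl => /= /andP[/andP[]].
have bl : all (gtn b) l by case/andP: dl'.
case: w => [|h w] in pw av1 av2 *; first by move/perm_size: pw.
have sub : subseq w (h :: w) by rewrite subseq_cons.
have av1' := avoids_subseq sub av1; have av2' := avoids_subseq sub av2.
case: (h =P a) => [ha|nha].
  move: pw; rewrite ha perm_cons => pw.
  have [bs sz ->] := IH b w dl' pw av1' av2'.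
  by exists (true :: bs); rewrite /= ?sz.
case: (h =P b) => [hb|nhb].
  move: pw; rewrite hb -(cat1s a) -(cat1s b l) perm_sym perm_catCA perm_cons perm_sym.
  move=> pw; have [bs sz ->] := IH a w dl'' pw av1' av2'.
  by exists (false :: bs); rewrite /= ?sz.
have hl : h < b.
  have : h \in [:: a, b & l] by rewrite -(perm_mem pw) mem_head.
  by rewrite !inE (introF eqP nha) (introF eqP nhb) => /(allP bl).
have aw : a \in w.
  have : a \in h :: w by rewrite (perm_mem pw) mem_head.
  by rewrite inE => /orP[/eqP/esym/nha|].
have bw : b \in w.
  have : b \in h :: w by rewrite (perm_mem pw) !inE eqxx orbT.
  by rewrite inE => /orP[/eqP/esym/nhb|].
have nab : a != b by lia.
(* A first letter below both [a] and [b] is followed by them in one of the two orders, giving 132 or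
   123. *)
case: (subseq_pair nab aw bw) => ss.
  have := av1 h a b; rewrite [subseq _ _]/= eqxx => /(_ ss) /=; lia.
have := av2 h b a; rewrite [subseq _ _]/= eqxx => /(_ ss) /=; lia.
Qed.

Lemma top2_word_inj a l bs1 bs2 : pairwise gtn (a :: l) ->
  size bs1 = size l -> size bs2 = size l ->
  top2_word a l bs1 = top2_word a l bs2 -> bs1 = bs2.
Proof.
elim: l a bs1 bs2 => [|b l IH] a [|x bs1] [|y bs2] // dl sz1 sz2.
have dl' : pairwise gtn (b :: l) by case/andP: dl.
have dl'' := pairwise_gtn_skip dl.
have ba : b < a by move: dl => /= /andP[/andP[]].
case: sz1 sz2 => sz1 [sz2] /=; case: x y => -[] [].
- by move=> /(IH _ _ _ dl' sz1 sz2) ->.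
- by move=> e; rewrite e ltnn in ba.
- by move=> e; rewrite e ltnn in ba.
- by move=> /(IH _ _ _ dl'' sz1 sz2) ->.
Qed.

(** * Words avoiding 132 and 213 *)

(* cur is the part already known of an increasing block whose letters all exceed
   the remaining letters l, listed in decreasing order. *)
Fixpoint block_word (cur l : seq nat) (bs : seq bool) : seq nat :=
  match l, bs with
  | b :: l', x :: bs' =>
      if x then cur ++ block_word [:: b] l' bs' else block_word (b :: cur) l' bs'
  | _, _ => cur
  end.

(** [k] is the length of the run of zeros being read. *)
Fixpoint zero_run (k : nat) (bs : seq bool) : nat :=
  if bs is x :: bs' then
    if x then maxn k (zero_run 0 bs') else zero_run k.+1 bs'
  else k.

Lemma block_word_perm cur l bs :
  size bs = size l -> perm_eq (block_word cur l bs) (cur ++ l).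
Proof.
elim: l cur bs => [|b l IH] cur [|x bs] //= sz; first by rewrite cats0.
case: sz => sz; case: x; first by rewrite perm_cat2l IH.
by rewrite (perm_trans (IH _ _ sz)) //= -(cat1s b (cur ++ l)) -(cat1s b l) perm_catCA.
Qed.

Definition block_state (cur l : seq nat) : bool :=
  [&& cur != [::], pairwise ltn cur, pairwise gtn l & allrel gtn cur l].

Lemma block_state_break cur b l : block_state cur (b :: l) -> block_state [:: b] l.
Proof. by case/and4P => _ _ /= /andP[bl dl] _; rewrite /block_state /= dl allrel1l bl. Qed.

Lemma block_state_push cur b l :
  block_state cur (b :: l) -> block_state (b :: cur) l.
Proof.
case/and4P => ncur icur /= /andP[bl dl]; rewrite allrel_consr => /andP[cb cl].
by rewrite /block_state /= icur dl allrel_consl bl cl !andbT /=; exact: cb.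
Qed.

Lemma block_word_lt cur b l bs : block_state cur (b :: l) -> size bs = size l ->
  allrel gtn cur (block_word [:: b] l bs).
Proof.
case/and4P => _ _ _ /allrelP h sz; apply/allrelP => x y xc.
by rewrite (perm_mem (block_word_perm _ sz)); exact: h.
Qed.

(** Later blocks are lower, so an increasing subsequence stays in one block. A block of [k] letters
    comes from [k - 1] zeros, whence the predecessor and the final successor. *)
Lemma lis_block_word cur l bs : block_state cur l -> size bs = size l ->
  lis ltn (block_word cur l bs) = (zero_run (size cur).-1 bs).+1.
Proof.
elim: l cur bs => [|b l IH] cur [|x bs] // st sz.
  by case/and4P: st => + icur _ _ /=; rewrite lis_pairwise //; case: (cur).
case: sz => sz; case: x => /=.
  rewrite lis_cat_none; last first.
    by move=> y z /(allrelP (block_word_lt st sz) _ _)/[apply] /=; lia.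
  rewrite (IH _ _ (block_state_break st) sz) /=.
  case/and4P: st => + icur _ _; rewrite lis_pairwise // => /=.
  by case: (cur) => //= ? ? _; lia.
rewrite (IH _ _ (block_state_push st) sz) /=.
by case/and4P: st; case: (cur).
Qed.

(** A decreasing subsequence takes at most one letter of the increasing block, and any letter of the
    block can precede everything in [w]. *)
Lemma lds_block_cat cur w : cur != [::] -> pairwise ltn cur -> allrel gtn cur w ->
  lis gtn (cur ++ w) = (lis gtn w).+1.
Proof.
elim: cur => // c cur IH _ /= /andP[cc icur]; rewrite allrel_consl => /andP[cw rw].
rewrite lis_cons filter_cat (all_filterP cw) (filter_none cc) /=; last first.
  by move=> y /=; lia.
case: cur => [|c' cur] in cc icur rw IH *; first by rewrite /=; lia.
by rewrite IH //; lia.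
Qed.

Lemma lds_block_word cur l bs : block_state cur l -> size bs = size l ->
  lis gtn (block_word cur l bs) = (count id bs).+1.
Proof.
elim: l cur bs => [|b l IH] cur [|x bs] // st sz.
  case/and4P: st => ncur icur _ _ /=.
  by rewrite -[cur]cats0 lds_block_cat ?lis_nil // allrel0r.
case: sz => sz; case: x => /=.
  have /and4P[ncur icur _ _] := st.
  by rewrite lds_block_cat ?(block_word_lt st sz) // (IH _ _ (block_state_break st)).
by rewrite (IH _ _ (block_state_push st)).
Qed.

(** Let [c] be the first letter of an occurrence in [c :: cur ++ w]. As the 1 of 132, it forces the
    other two into [cur], which increases; as the 2 of 213, it forces the 1 into [w], and then the 3
    lies in [w], below [c]. *)
Lemma avoids_block_cat cur w : pairwise ltn cur -> allrel gtn cur w ->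
  avoids (1, 3, 2) w -> avoids (2, 1, 3) w ->
  avoids (1, 3, 2) (cur ++ w) /\ avoids (2, 1, 3) (cur ++ w).
Proof.
move=> + + av1 av2; elim: cur => // c cur IH /= /andP[/allP cc icur].
rewrite allrel_consl => /andP[/allP cw rw]; have [av1' av2'] := IH icur rw.
split; apply: avoids_cons => // u v /subseq2_cat [/[dup] ss /subseq2_mem|[|/subseq2_mem]].
- move=> [/cc /= hu /cc /= hv]; have := subseq_pairwise ss icur; rewrite /=; lia.
- by move=> [/cc /= hu /cw /= hv]; lia.
- by move=> [/cw /= hu /cw /= hv]; lia.
- by move=> [/cc /= hu /cc /= hv]; lia.
- by move=> [/cc /= hu /cw /= hv]; lia.
- by move=> [/cw /= hu /cw /= hv]; lia.
Qed.

Lemma avoids_block_word cur l bs : block_state cur l -> size bs = size l ->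
  avoids (1, 3, 2) (block_word cur l bs) /\ avoids (2, 1, 3) (block_word cur l bs).
Proof.
elim: l cur bs => [|b l IH] cur [|x bs] // st sz.
  case/and4P: st => ncur icur _ _ /=.
  by rewrite -[cur]cats0; apply: avoids_block_cat; rewrite ?allrel0r //;
    move=> ? ? ? /size_subseq.
case: sz => sz; case: x => /=; last exact: IH (block_state_push st) sz.
have /and4P[ncur icur _ _] := st.
have [av1 av2] := IH _ _ (block_state_break st) sz.
by apply: avoids_block_cat; rewrite ?(block_word_lt st sz).
Qed.

(** [z] and [v] are the letters before and after the current block, which starts with [c]. If the
    next letter [b] is in [z], it touches the block, since otherwise [b y c] is 213; the bit is 0.
    If [b] is in [v], then [z] is empty, since otherwise [y c b] is 132; the bit is 1. *)
Lemma block_word_surj cur l z v : block_state cur l -> perm_eq (z ++ v) l ->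
  avoids (1, 3, 2) (z ++ cur ++ v) -> avoids (2, 1, 3) (z ++ cur ++ v) ->
  exists2 bs, size bs = size l & z ++ cur ++ v = block_word cur l bs.
Proof.
elim: l cur z v => [|b l IH] cur z v st pw av1 av2.
  have := perm_size pw; rewrite size_cat; case: z v => [|? ?] [|? ?] //= in pw av1 av2 *.
  by exists [::]; rewrite // cats0.
have /and4P[ncur icur dl /allrelP rl] := st.
have /andP[/allP bl _] := dl.
have ul : uniq (z ++ v).
  rewrite (perm_uniq pw) (pairwise_uniq _ dl) // => x /=; exact: ltnn.
case: cur => // c cur in st ncur icur rl av1 av2 *.
have cb : b < c by apply: rl; rewrite mem_head.
have : b \in z ++ v by rewrite (perm_mem pw) mem_head.
rewrite mem_cat => /orP[] bz.
  case/splitPr: bz pw av1 av2 ul => z1 z2 pw av1 av2 ul.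
  case: z2 => [|y z2] in pw av1 av2 ul *.
    have [|||bs sz e] := IH (b :: c :: cur) z1 v (block_state_push st).
    - by move: pw; rewrite -catA perm_catCA cat1s perm_cons.
    - by move: av1; rewrite -catA.
    - by move: av2; rewrite -catA.
    by exists (false :: bs); [rewrite /= sz|rewrite /= -e -catA].
  have ss : subseq [:: b; y; c] ((z1 ++ b :: y :: z2) ++ (c :: cur) ++ v).
    rewrite -!catA; apply: subseq_trans (suffix_subseq _ _) => /=.
    by rewrite !eqxx sub1seq mem_cat mem_head orbT.
  have yl : y \in l.
    have : y \in b :: l.
      by rewrite -(perm_mem pw) !(mem_cat, inE) eqxx !orbT.
    rewrite inE => /orP[/eqP eyb|//]; move: ul; rewrite eyb -catA cat_uniq /=.
    by rewrite !inE eqxx /= !andbF.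
  have /= := bl _ yl; have := av2 _ _ _ ss; rewrite /=; lia.
case: z => [|y z] in pw av1 av2 ul *.
  case/splitPr: bz pw av1 av2 ul => v1 v2 pw av1 av2 ul.
  have sub : subseq (v1 ++ b :: v2) ([::] ++ (c :: cur) ++ v1 ++ b :: v2).
    by rewrite cat0s suffix_subseq.
  have [|||bs sz e] := IH [:: b] v1 v2 (block_state_break st).
  - by move: pw; rewrite cat0s -(cat1s b v2) perm_catCA cat1s perm_cons.
  - exact: avoids_subseq sub av1.
  - exact: avoids_subseq sub av2.
  by exists (true :: bs); [rewrite /= sz|rewrite /= -e].
have ss : subseq [:: y; c; b] ((y :: z) ++ (c :: cur) ++ v).
  rewrite /= eqxx; apply: subseq_trans (suffix_subseq _ _) => /=.
  by rewrite eqxx sub1seq mem_cat bz orbT.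
have yl : y \in l.
  have : y \in b :: l by rewrite -(perm_mem pw) mem_head.
  rewrite inE => /orP[/eqP eyb|//]; move: ul; rewrite eyb /=.
  by rewrite mem_cat bz orbT.
have /= := bl _ yl; have := av1 _ _ _ ss; rewrite /=; lia.
Qed.

Lemma block_word_head cur l bs : cur != [::] -> size bs = size l ->
  head 0 (block_word cur l bs) \in head 0 cur :: l.
Proof.
elim: l cur bs => [|b l IH] cur [|x bs] // ncur sz; first by rewrite mem_head.
case: sz => sz; case: x => /=.
  by case: cur ncur => //= c cur _; rewrite mem_head.
by rewrite in_cons (IH (b :: cur)) ?orbT.
Qed.

Lemma block_word_inj cur l bs1 bs2 : block_state cur l ->
  size bs1 = size l -> size bs2 = size l ->
  block_word cur l bs1 = block_word cur l bs2 -> bs1 = bs2.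
Proof.
elim: l cur bs1 bs2 => [|b l IH] cur [|x bs1] [|y bs2] // st sz1 sz2.
(* Closing the block leaves the head of [cur] in front, whereas extending it puts [b] or a later
   letter there, all smaller. *)
have neq s s' : size s = size l -> size s' = size l ->
    block_word cur (b :: l) (true :: s) = block_word cur (b :: l) (false :: s') -> False.
  move=> sz sz' e; have /and4P[ncur _ _ /allrelP rl] := st.
  have := block_word_head (cur := b :: cur) isT sz'.
  move: e => /= <-; case: cur ncur rl {st} => // c cur _ rl h.
  by have := rl c c (mem_head _ _) h; rewrite /= ltnn.
case: sz1 sz2 => sz1 [sz2]; case: x y => -[].
- move=> /= /eqP; rewrite eqseq_cat // => /andP[_ /eqP].
  by move=> /(IH _ _ _ (block_state_break st) sz1 sz2) ->.
- by move/neq => /(_ sz1 sz2).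
- by move/esym/neq => /(_ sz2 sz1).
- by move=> /= /(IH _ _ _ (block_state_push st) sz1 sz2) ->.
Qed.

(** This links the recursion to the windows of [longest_zero_run]; the [k] zeros put in front of
    [bs] carry the induction. *)
Lemma leq_zero_runP l k bs :
  reflect (exists2 i, i + l <= k + size bs &
             forall j, j < l -> ~~ nth false (nseq k false ++ bs) (i + j))
    (l <= zero_run k bs).
Proof.
elim: bs l k => [|x bs IH] l k /=.
  apply: (iffP idP) => [le|[i + _]]; last by lia.
  by exists 0; rewrite ?cats0; [lia|move=> j _; rewrite nth_nseq; case: ifP].
case: x => /=; last first.
  have -> : nseq k false ++ false :: bs = nseq k.+1 false ++ bs.
    by rewrite -cat_rcons; congr (_ ++ _); elim: k => //= k ->.
  by rewrite -addSnnS; exact: IH.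
have nthE i : nth false (nseq k false ++ true :: bs) i =
    if i < k then false else if i == k then true else nth false bs (i - k.+1).
  rewrite nth_cat size_nseq nth_nseq; case: ltnP => [//|le].
  case: eqP => [->|ne]; first by rewrite subnn.
  by have -> : i - k = (i - k.+1).+1 by lia.
rewrite leq_max; apply: (iffP orP) => [[le|/IH[i /= le h]]|[i le h]].
- exists 0; first by lia.
  by move=> j jl; rewrite nthE; have -> : 0 + j < k by lia.
- exists (k.+1 + i); first by lia.
  move=> j jl; rewrite nthE; have -> : (k.+1 + i + j < k) = false by lia.
  have -> : (k.+1 + i + j == k) = false by lia.
  have -> : k.+1 + i + j - k.+1 = i + j by lia.
  exact: h.
case: (leqP l k) => [|lk]; [by left|right; apply/IH].
case: (ltnP k i) => [ki|ik]; last first.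
  (* A window longer than [k] that starts at or before position [k] covers that position, which
     holds a one. *)
  by have := h (k - i); rewrite nthE (subnKC ik) ltnn eqxx => /(_ ltac:(lia)).
exists (i - k.+1); first by rewrite /=; lia.
move=> j jl; have := h j jl; rewrite nthE /=.
have -> : (i + j < k) = false by lia.
have -> : (i + j == k) = false by lia.
by have -> : i + j - k.+1 = i - k.+1 + j by lia.
Qed.

(** * Permutations and their words *)

Definition word (n : nat) (s : 'S_n) : seq nat := [seq val (s i) | i <- enum 'I_n].

Lemma word_inj n : injective (@word n).
Proof.
move=> s t /eq_in_map e; apply/permP => i; apply/val_inj/e.
by rewrite mem_enum.
Qed.

Lemma word_perm n (s : 'S_n) : perm_eq (word s) (iota 0 n).
Proof.
apply: uniq_perm; rewrite ?iota_uniq //.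
  by rewrite map_inj_uniq ?enum_uniq // => i j /val_inj/perm_inj.
move=> k; rewrite mem_iota; apply/mapP/idP => [[i _ ->]|kn]; first exact: ltn_ord.
by exists ((s^-1)%g (Ordinal kn)); rewrite ?mem_enum // permKV.
Qed.

Lemma word_surj n w : perm_eq w (iota 0 n) -> exists s : 'S_n, word s = w.
Proof.
case/(@tuple_permP _ n w (iota_tuple n 0)) => s ->; exists s.
by apply: eq_map => i; rewrite (tnth_nth 0) /= nth_iota.
Qed.

Lemma subseq_word n (s : 'S_n) (t : seq nat) :
  subseq t (word s) <->
  exists2 u, subseq u (enum 'I_n) & t = [seq val (s i) | i <- u].
Proof.
split=> [/subseqP[m sm ->]|[u su ->]]; last exact: map_subseq.
by exists (mask m (enum 'I_n)); rewrite ?mask_subseq // map_mask.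
Qed.

(** A strictly increasing list is the filter of the enumeration by its own members: both are sorted
    with the same elements. *)
Lemma subseq_enum_ord n (u : seq 'I_n) :
  subseq u (enum 'I_n) = pairwise (fun i j : 'I_n => i < j) u.
Proof.
have srt : pairwise (fun i j : 'I_n => i < j) (enum 'I_n).
  by rewrite -(pairwise_map val ltn) val_enum_ord -sorted_pairwise
    ?iota_ltn_sorted //; exact: ltn_trans.
apply/idP/idP => [/subseq_pairwise/(_ srt) //|pu].
have tr : transitive (fun i j : 'I_n => i < j) by move=> ? ? ?; exact: ltn_trans.
have ir : irreflexive (fun i j : 'I_n => i < j) by move=> ?; exact: ltnn.
suff -> : u = seq.filter (mem u) (enum 'I_n) by exact: filter_subseq.
apply: (irr_sorted_eq tr ir); first by rewrite sorted_pairwise.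
  by rewrite sorted_pairwise //; exact: pairwise_filter.
by move=> i; rewrite mem_filter mem_enum andbT.
Qed.

Lemma max_pairwise_set n (s : 'S_n) (r : rel nat) :
  \max_(A : {set 'I_n} |
      [forall i : 'I_n in A, forall j : 'I_n in A, (i < j) ==> r (s i) (s j)]) #|A| =
  lis r (word s).
Proof.
apply/eqP; rewrite eqn_leq; apply/andP; split.
  apply/bigmax_leqP => A /forall_inP hA.
  have su : subseq (enum A) (enum 'I_n).
    by rewrite [X in subseq _ X]enumT; exact: filter_subseq.
  rewrite cardE -(size_map (fun i => val (s i))); apply: leq_lis.
    exact: map_subseq.
  rewrite pairwise_map; move: (su); rewrite subseq_enum_ord => pu.
  apply/pairwise_subseq2 => i j ss.
  have [] := subseq2_mem ss; rewrite !mem_enum => iA jA.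
  have /= := subseq_pairwise ss pu; rewrite !andbT => ij.
  by have /forall_inP/(_ j jA)/implyP/(_ ij) := hA i iA.
have [t [/subseq_word[u su ->] pt <-]] := lis_ex r (word s).
have uu : uniq u by rewrite (subseq_uniq su) ?enum_uniq.
rewrite size_map -(card_uniqP uu).
have -> : #|u| = #|[set i in u]| by apply: eq_card => i; rewrite inE.
apply: (leq_bigmax_cond (F := fun A : {set 'I_n} => #|A|)).
apply/forall_inP => i; rewrite inE => iu; apply/forall_inP => j; rewrite inE => ju.
apply/implyP => ij; move: pt; rewrite pairwise_map => /pairwise_subseq2; apply.
have nij : i != j by apply/negP => /eqP e; rewrite e ltnn in ij.
case: (subseq_pair nij iu ju) => // ss; move: su; rewrite subseq_enum_ord.
by move=> /(subseq_pairwise ss) /=; rewrite !andbT ltnNge (ltnW ij).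
Qed.

Lemma LIS_word n (s : 'S_n) : LIS s = lis ltn (word s).
Proof. exact: (max_pairwise_set s ltn). Qed.

Lemma LDS_word n (s : 'S_n) : LDS s = lis gtn (word s).
Proof. exact: (max_pairwise_set s gtn). Qed.

Lemma contains_word n (s : 'S_n) (x y z : nat) : perm_eq [:: x; y; z] (iota 1 3) ->
  contains s (pattern [:: x; y; z]) <->
  exists a b c : nat, subseq [:: a; b; c] (word s) /\ order_iso3 (x, y, z) a b c.
Proof.
move=> pxyz; set p := pattern _.
have pE (i j : 'I_3) : (p i < p j) = (nth 0 [:: x; y; z] i < nth 0 [:: x; y; z] j).
  by rewrite -!(onelineE _ pxyz) ltnS.
have xyz : [/\ x != y, x != z & y != z].
  have : uniq [:: x; y; z] by rewrite (perm_uniq pxyz).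
  by rewrite /= !inE negb_or andbT => /andP[/andP[]].
pose o0 : 'I_3 := @Ordinal 3 0 isT; pose o1 : 'I_3 := @Ordinal 3 1 isT.
pose o2 : 'I_3 := @Ordinal 3 2 isT.
split=> [/existsP[f /andP[/forallP fi /forallP fp]]|[a [b [c [/subseq_word[u su e] iso]]]]].
  have fiE (i j : 'I_3) : i < j -> f i < f j by move: (fi i) => /forallP/(_ j)/implyP.
  have fpE (i j : 'I_3) : (s (f i) < s (f j)) = (p i < p j).
    by have /forallP/(_ j)/eqP := fp i.
  exists (val (s (f o0))), (val (s (f o1))), (val (s (f o2))); split.
    apply/subseq_word; exists [:: f o0; f o1; f o2] => //.
    by rewrite subseq_enum_ord /= !fiE.
  by rewrite /order_iso3 !fpE !pE /= !eqxx.
case: u su e => [|i [|j [|k [|? ?]]]] // su [ea eb ec].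
move: iso; rewrite {}ea {}eb {}ec => /and3P[/eqP e1 /eqP e2 /eqP e3].
move: (su); rewrite subseq_enum_ord /= !andbT => /andP[/andP[ij ik] jk].
apply/existsP; exists [ffun t : 'I_3 => nth i [:: i; j; k] t].
(* [order_iso3] records three comparisons only; injectivity of [s] determines the reverse ones. *)
have nv (i' j' : 'I_n) : i' < j' -> (s j' < s i') = ~~ (s i' < s j').
  move=> ab; rewrite -leqNgt ltn_neqAle andb_idl // => _.
  apply/negP => /eqP/val_inj/perm_inj ba; by rewrite ba ltnn in ab.
case: xyz => nxy nxz nyz.
apply/andP; split; apply/forallP => -[[|[|[|t]]] ht] //;
  apply/forallP => -[[|[|[|t']]] ht'] //; rewrite !ffunE ?pE /=;
  rewrite ?ltnn ?eqxx ?ij ?ik ?jk ?(nv _ _ ij) ?(nv _ _ ik) ?(nv _ _ jk) ?e1 ?e2 ?e3 //;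
  lia.
Qed.

Lemma avoids_word n (s : 'S_n) (x y z : nat) : perm_eq [:: x; y; z] (iota 1 3) ->
  ~~ contains s (pattern [:: x; y; z]) <-> avoids (x, y, z) (word s).
Proof.
move=> pxyz; split=> [/negP h a b c ss|h]; last first.
  by apply/negP => /(contains_word s pxyz)[a [b [c [/h/negP]]]].
by apply/negP => iso; apply: h; apply/(contains_word s pxyz); exists a, b, c.
Qed.

Section TwoPatterns.
Variables (n : nat) (x y z x' y' z' : nat).
Hypotheses (pxyz : perm_eq [:: x; y; z] (iota 1 3))
  (pxyz' : perm_eq [:: x'; y'; z'] (iota 1 3)).
Let S : {set 'S_n} :=
  avoiders n [set pattern [:: x; y; z]; pattern [:: x'; y'; z']].

Lemma mem_avoiders (s : 'S_n) :
  s \in S <-> avoids (x, y, z) (word s) /\ avoids (x', y', z') (word s).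
Proof.
rewrite inE -!avoids_word //; split=> [/forall_inP h|[h h'] ].
  by split; apply: h; rewrite !inE eqxx ?orbT.
by apply/forall_inP => p; rewrite !inE => /orP[]/eqP ->.
Qed.

Lemma perm_words (ws : seq (seq nat)) : uniq ws ->
  (forall w, w \in ws -> perm_eq w (iota 0 n)) ->
  (forall w, w \in ws -> avoids (x, y, z) w /\ avoids (x', y', z') w) ->
  (forall w, perm_eq w (iota 0 n) -> avoids (x, y, z) w ->
     avoids (x', y', z') w -> w \in ws) ->
  perm_eq (map (@word n) (enum S)) ws.
Proof.
move=> uws ws_perm ws_av av_ws; apply: uniq_perm => //.
  by rewrite map_inj_uniq ?enum_uniq //; exact: word_inj.
move=> w; apply/mapP/idP => [[s]|ww].
  rewrite mem_enum => /mem_avoiders [h h'] ->.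
  by apply: av_ws => //; exact: word_perm.
have [s e] := word_surj (ws_perm _ ww); exists s => //.
by rewrite mem_enum; apply/mem_avoiders; rewrite e; exact: ws_av.
Qed.

Lemma perm_words_bits (f : seq bool -> seq nat) (m : nat) :
  (forall bs, size bs = m -> perm_eq (f bs) (iota 0 n)) ->
  (forall bs, size bs = m -> avoids (x, y, z) (f bs) /\ avoids (x', y', z') (f bs)) ->
  (forall w, perm_eq w (iota 0 n) -> avoids (x, y, z) w -> avoids (x', y', z') w ->
     exists2 bs, size bs = m & w = f bs) ->
  (forall bs1 bs2, size bs1 = m -> size bs2 = m -> f bs1 = f bs2 -> bs1 = bs2) ->
  perm_eq (map (@word n) (enum S)) (map f (allbits m)).
Proof.
move=> f_perm f_av f_surj f_inj; apply: perm_words.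
- rewrite map_inj_in_uniq ?allbits_uniq // => b1 b2; rewrite !mem_allbits.
  by move=> /eqP h1 /eqP h2; exact: f_inj.
- by move=> w /mapP[bs]; rewrite mem_allbits => /eqP h ->; exact: f_perm.
- by move=> w /mapP[bs]; rewrite mem_allbits => /eqP h ->; exact: f_av.
- move=> w pw h h'; have [bs sz ->] := f_surj w pw h h'.
  by rewrite map_f // mem_allbits sz.
Qed.
End TwoPatterns.

Lemma lis_avoids_increasing w : avoids (1, 2, 3) w -> lis ltn w <= 2.
Proof.
move=> av; apply/lis_leP => -[|a [|b [|c t]]] // ss.
have := av a b c (subseq_trans (prefix_subseq [:: a; b; c] t) ss).
by rewrite /=; lia.
Qed.

Lemma lis_avoids_decreasing w : avoids (3, 2, 1) w -> lis gtn w <= 2.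
Proof.
move=> av; apply/lis_leP => -[|a [|b [|c t]]] // ss.
have := av a b c (subseq_trans (prefix_subseq [:: a; b; c] t) ss).
by rewrite /=; lia.
Qed.

Local Open Scope classical_set_scope.
Local Open Scope ring_scope.

(** * Laws of functions of fair bits *)

(** Any nonzero value is read as the bit [true], so the identity holds for every real sequence. *)
Lemma longest_zero_runE (R : realType) (m : nat) (x : nat -> R) :
  longest_zero_run m x = zero_run 0 [seq x j != 0 | j <- iota 1 m].
Proof.
set bs := map _ _; have sz : size bs = m by rewrite size_map size_iota.
have nthE j : (j < m)%N -> ~~ nth false bs j = (x j.+1 == 0).
  by move=> jm; rewrite (nth_map 0%N) ?size_iota // nth_iota // add1n negbK.
apply/eqP; rewrite eqn_leq; apply/andP; split.
  apply/bigmax_leqP => l /existsP[i /andP[le /forallP h]].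
  apply/leq_zero_runP; exists i; first by rewrite add0n sz.
  by move=> j jl; rewrite /= nthE; [exact: (h (Ordinal jl))|lia].
have /leq_zero_runP[i] := leqnn (zero_run 0 bs); rewrite add0n sz => le h.
have lm : (zero_run 0 bs < m.+1)%N by lia.
have im : (i < m.+1)%N by lia.
apply: (leq_bigmax_cond (Ordinal lm) (F := fun l : 'I_m.+1 => val l)).
apply/existsP; exists (Ordinal im); rewrite /= le; apply/forallP => j.
by have jl := ltn_ord j; rewrite -nthE; [exact: h|lia].
Qed.

Lemma zero_runs_sum (R : comNzRingType) (p x : bool) (bs : seq bool) :
  (zero_runs p (x :: bs))%:R = p%:R * (1 - x%:R) +
  \sum_(0 <= i < size bs)
     (1 - (nth false (x :: bs) i.+1)%:R) * (nth false (x :: bs) i)%:R :> R.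
Proof.
have b2 (u v : bool) : (u && ~~ v)%:R = u%:R * (1 - v%:R) :> R.
  by case: u; case: v => /=; ring.
elim: bs p x => [|y bs IH] p x; first by rewrite big_nil /= addn0 addr0 b2.
rewrite [zero_runs _ _]/= natrD b2; congr (_ + _).
rewrite -[X in X%:R]/(zero_runs x (y :: bs)) IH.
rewrite [in RHS]big_nat_recl //=; congr (_ + _).
exact: mulrC.
Qed.

Lemma Tvar_bits (R : realType) (n : nat) (x : nat -> R) (bs : seq bool) :
  (3 <= n)%N -> size bs = n.-1 ->
  (forall i, (i < n.-1)%N -> x i.+1 = (nth false bs i)%:R) ->
  Tvar n x = n%:R - (zero_runs true bs)%:R.
Proof.
case: n => [|[|[|k]]] // _; case: bs => // b bs [sz] xE.
rewrite zero_runs_sum sz /Tvar /=.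
set B := fun i => (nth false (b :: bs) i)%:R : R.
have -> : \sum_(2 <= i < k.+2) x i = \sum_(0 <= i < k) B i.+1.
  rewrite -{1}[2%N]add0n -[k.+2]addn2 big_addn addnK.
  by apply: eq_big_nat => i hi; rewrite addn2 xE //=; lia.
have -> : \sum_(2 <= i < k.+3) x i * x i.-1 = \sum_(0 <= i < k.+1) B i.+1 * B i.
  rewrite -{1}[2%N]add0n -[k.+3]addn2 big_addn addnK.
  by apply: eq_big_nat => i hi; rewrite addn2 !xE //=; lia.
have -> : \sum_(0 <= i < k.+1) (1 - (nth false bs i)%:R) * (nth false (b :: bs) i)%:R
    = \sum_(0 <= i < k.+1) B i - \sum_(0 <= i < k.+1) B i.+1 * B i.
  by rewrite -sumrB; apply: eq_bigr => i _; rewrite mulrBl mul1r.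
(* The split-off term [B 0], which is the first coin, cancels against the [1 - X_1] of an initial
   run. *)
rewrite [\sum_(0 <= i < k.+1) B i]big_nat_recl //.
by rewrite -[B 0%N]/(b%:R); ring.
Qed.

Lemma count_natE (T : Type) (p : pred T) (s : seq T) (R : pzSemiRingType) :
  (count p s)%:R = \sum_(t <- s) (p t)%:R :> R.
Proof. by rewrite -sum1_count natr_sum big_mkcond; apply: eq_bigr => t _; case: (p t). Qed.

Lemma uniform_on_law (R : realType) (T : finType) (A : {set T}) (f : T -> nat)
    (vals : seq nat) (B : set R) : perm_eq (map f (enum A)) vals ->
  uniform_on R A ((fun t => (f t)%:R) @^-1` B) =
  ((count (fun k => k%:R \in B) vals)%:R / (size vals)%:R)%:E.
Proof.
move=> pv; rewrite /uniform_on; congr (_%:R / _%:R)%:E; last first.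
  by rewrite -(perm_size pv) size_map -cardE.
rewrite -(seq.permP pv) count_map -size_filter cardE; congr size.
rewrite {1}/enum_mem -filter_predI; apply: eq_filter => t /=.
by rewrite !inE andbC; congr (_ && _); apply/idP/idP; rewrite !inE.
Qed.

Lemma count_bits_binomial (m : nat) (p : pred nat) :
  count (fun bs => p (count id bs)) (allbits m) =
  (\sum_(k < m.+1) 'C(m, k) * p k)%N.
Proof.
rewrite -sum1_count big_mkcond /=.
(* Bit strings are grouped by their number of ones. *)
transitivity (\sum_(bs <- allbits m) \sum_(k < m.+1) (count id bs == k) * p k)%N.
  apply: eq_big_seq => bs; rewrite mem_allbits => /eqP sz.
  have le : (count id bs < m.+1)%N by rewrite ltnS -sz count_size.
  rewrite (bigD1 (Ordinal le)) //= eqxx mul1n big1 ?addn0; first by case: (p _).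
  by move=> k; rewrite -val_eqE /= eq_sym => /negPf ->.
rewrite exchange_big; apply: eq_bigr => k _ /=.
rewrite -big_distrl /= -count_allbits; congr (_ * _)%N.
by rewrite -sum1_count [RHS]big_mkcond; apply: eq_bigr => bs _; case: eqP.
Qed.

Lemma binomial_bits (R : realType) (m : nat) (B : set R) :
  binomial_prob m (1 / 2 : R) ((fun k : nat => k%:R + 1 : R) @^-1` B) =
  ((count (fun bs => (count id bs).+1%:R \in B) (allbits m))%:R / (2 ^ m)%:R)%:E.
Proof.
have p0 : 0 <= 1 / 2 :> R by lra.
have p1 : (NngNum p0)%:num <= 1 :> R by rewrite /=; lra.
rewrite (binomial_probE _ p1) (count_bits_binomial m (fun k => k.+1%:R \in B)).
rewrite natr_sum mulr_suml -sumEFin; apply: eq_bigr => k _.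
rewrite diracE -EFinM; congr (_%:E) => /=.
have -> : (nat_of_ord k \in (fun k => k%:R + 1) @^-1` B) = ((k.+1)%:R \in B).
  by rewrite -natr1; apply/idP/idP; rewrite !inE.
have -> : unstable.onem (1 / 2) = 1 / 2 :> R by rewrite /unstable.onem; lra.
(* At parameter 1/2 the weight of [k] successes and [m - k] failures is the same for every [k]. *)
rewrite -exprD subnKC; last by rewrite -ltnS.
by rewrite natrM natrX -mulr_natr expr_div_n expr1n mul1r; ring.
Qed.

Section Coins.
Context (R : realType) (d : measure_display) (Omega : measurableType d).
Context (P : probability Omega R) (X : nat -> {RV P >-> R}).
Hypothesis fairX : fair_coins X.

Fixpoint bits_event (i : nat) (bs : seq bool) : set Omega :=
  if bs is b :: bs' then X i @^-1` [set b%:R] `&` bits_event i.+1 bs' else setT.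

Lemma bits_eventP i bs w : bits_event i bs w <->
  forall k, (k < size bs)%N -> X (i + k)%N w = (nth false bs k)%:R.
Proof.
elim: bs i => [|b bs IH] i /=; first by split.
split=> [[h0 /IH h] [|k]|h]; [by rewrite addn0|by move=> /h; rewrite addSnnS|].
split; first by have := h 0%N isT; rewrite addn0.
by apply/IH => k hk; rewrite addSnnS; exact: h k.+1 hk.
Qed.

Lemma measurable_coin i (r : R) : measurable (X i @^-1` [set r]).
Proof. by apply: measurable_funPTI; exact: measurable_set1. Qed.

(** A coin may take values other than 0 and 1, but only on a null set, because the two given
    probabilities add up to 1. *)
Lemma coin_split i (A : set Omega) : (1 <= i)%N -> measurable A ->
  P A = (P (A `&` X i @^-1` [set 1%R]) + P (A `&` X i @^-1` [set 0%R]))%E.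
Proof.
move=> i1 mA; have [_ /(_ i i1) [P1 P0]] := fairX.
set E1 := X i @^-1` [set 1]; set E0 := X i @^-1` [set 0].
have m1 : measurable E1 by exact: measurable_coin.
have m0 : measurable E0 by exact: measurable_coin.
have dis : E1 `&` E0 = set0.
  apply/seteqP; split=> // w []; rewrite /E1 /E0 /preimage /= => -> /eqP.
  by rewrite oner_eq0.
have null : P (~` (E1 `|` E0)) = 0%E.
  rewrite probability_setC; last exact: measurableU.
  rewrite measureU // [X in (_ - (X + _))%E]P1 [X in (_ - (_ + X))%E]P0.
  rewrite -EFinD; have -> : 1 / 2 + 1 / 2 = 1 :> R by lra.
  by rewrite subrr.
rewrite (measureDI P mA m1) addeC; congr (_ + _)%E.
have mD : measurable (A `\` E1) by exact: measurableD.
rewrite (measureDI P mD m0) [X in (X + _)%E](_ : _ = 0%E); last first.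
  apply/eqP; rewrite eq_le measure_ge0 andbT -null; apply: le_measure.
  - by rewrite inE; exact: measurableD.
  - by rewrite inE; apply: measurableC; exact: measurableU.
  - by move=> w [[_ n1] n0] [].
rewrite add0e; congr (P _); apply/seteqP; split=> w; first by case=> -[].
by move=> [Aw E0w]; split=> //; split=> // E1w; have : (E1 `&` E0) w by []; rewrite dis.
Qed.

Lemma coins_split m i (A : set Omega) : (1 <= i)%N -> measurable A ->
  P A = (\sum_(bs <- allbits m) P (A `&` bits_event i bs))%E.
Proof.
elim: m i A => [|m IH] i A i1 mA; first by rewrite /= big_seq1 setIT.
rewrite (coin_split i1 mA) /= big_cat !big_map /=.
have mAX r : measurable (A `&` X i @^-1` [set r]).
  by apply: measurableI => //; exact: measurable_coin.
by congr (_ + _)%E; rewrite (IH i.+1) //; apply: eq_bigr => bs _; rewrite setIA.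
Qed.

Lemma prob_bits_event bs : P (bits_event 1 bs) = ((2 ^ size bs)%:R^-1)%:E.
Proof.
have [indep half] := fairX.
(* Independence is applied to the coins 1 to [size bs]; the predecessor in [B] matches them with
   bits indexed from 0. *)
pose J : {fset nat} := [fset j in iota 1 (size bs)]%fset.
pose B j : set R := [set (nth false bs j.-1)%:R].
have memJ j : (j \in J) = (1 <= j <= size bs)%N by rewrite !inE mem_iota; lia.
have -> : bits_event 1 bs = \bigcap_(j in [set` J]) (X j @^-1` B j).
  apply/seteqP; split=> w.
    move=> /bits_eventP h j /=; rewrite memJ => hj.
    by have := h j.-1; rewrite add1n prednK //; [apply; lia|lia].
  by move=> h; apply/bits_eventP => k hk; apply: (h k.+1); rewrite /= memJ; lia.
rewrite indep; last 2 first.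
- by move=> j /=; rewrite memJ => /andP[].
- by move=> j; exact: measurable_set1.
rewrite (eq_big_seq (fun=> (1 / 2)%:E)); last first.
  move=> j; rewrite memJ => /andP[j1 _]; have [h1 h0] := half j j1.
  by rewrite /B; case: nth.
rewrite prodEFin; congr (_%:E); rewrite big_const_seq count_predT.
have -> : size J = size bs.
  by rewrite -[size J]/(#|` J|) card_fseq undup_id ?iota_uniq // size_iota.
by rewrite -Monoid.iteropE -/(_ ^+ _) natrX expr_div_n expr1n mul1r.
Qed.

(** The event need only be decided by the bits where the first [m] coins take values 0 or 1; the
    rest is null. *)
Lemma coins_law m (A : set Omega) (good : pred (seq bool)) : measurable A ->
  (forall bs w, size bs = m -> bits_event 1 bs w -> A w <-> good bs) ->
  P A = ((count good (allbits m))%:R / (2 ^ m)%:R)%:E.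
Proof.
move=> mA h; rewrite (coins_split m (isT : (1 <= 1)%N) mA).
rewrite count_natE mulr_suml -sumEFin; apply: eq_big_seq => bs.
rewrite mem_allbits => /eqP sz; case g: (good bs).
  rewrite mul1r -sz -prob_bits_event; congr (P _).
  by apply/seteqP; split=> [w []|w hw] //; split=> //; apply/(h _ _ sz hw).
rewrite (_ : A `&` _ = set0) ?measure0 ?mul0r //.
by apply/seteqP; split=> // w [Aw hw]; move/(h _ _ sz hw): Aw; rewrite g.
Qed.

Lemma measurable_bits m i (p : pred (seq bool)) :
  measurable [set w | p [seq X j w != 0 | j <- iota i m]].
Proof.
elim: m i p => [|m IH] i p /=.
  case: (p [::]); [have -> : [set _ : Omega | true] = setT|
                   have -> : [set _ : Omega | false] = set0] => //;
    by apply/seteqP; split.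
set E0 := X i @^-1` [set 0].
have m0 : measurable E0 by exact: measurable_coin.
rewrite [X in measurable X](_ : _ =
    (E0 `&` [set w | p (false :: [seq X j w != 0 | j <- iota i.+1 m])]) `|`
    (~` E0 `&` [set w | p (true :: [seq X j w != 0 | j <- iota i.+1 m])])).
  apply: measurableU; apply: measurableI => //.
  - exact: (IH i.+1 (fun s => p (false :: s))).
  - exact: measurableC.
  - exact: (IH i.+1 (fun s => p (true :: s))).
apply/seteqP; split=> w /=; rewrite /E0 /preimage /=.
  by case: eqP => h; [left|right].
by case=> -[h]; [rewrite h eqxx|move/eqP: h => ->].
Qed.

Lemma Tvar_law n (B : set R) : (3 <= n)%N -> measurable B ->
  P ((fun w => Tvar n (fun i => X i w)) @^-1` B) =
  ((count (fun bs => n%:R - (zero_runs true bs)%:R \in B) (allbits n.-1))%:R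
     / (2 ^ n.-1)%:R)%:E.
Proof.
move=> n3 mB; apply: coins_law.
  rewrite -[X in measurable X]setTI.
  suff mT : measurable_fun setT (fun w => Tvar n (fun i => X i w)) by exact: mT.
  rewrite /Tvar; apply: measurable_funD; last first.
    by apply: measurable_sum => i; apply: measurable_funM; exact: measurable_funPT.
  apply: measurable_funB => //.
  by apply: measurable_sum => i; exact: measurable_funPT.
move=> bs w sz /bits_eventP; rewrite sz => h.
by rewrite /= (Tvar_bits n3 sz) ?inE // => i hi; rewrite -add1n h.
Qed.

Lemma longest_zero_run_law m (B : set R) : measurable B ->
  P ((fun w => (longest_zero_run m (fun i => X i w))%:R + 1) @^-1` B) =
  ((count (fun bs => (zero_run 0 bs).+1%:R \in B) (allbits m))%:R / (2 ^ m)%:R)%:E.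
Proof.
move=> mB.
have e w : (longest_zero_run m (fun i => X i w))%:R + 1 =
    (zero_run 0 [seq X j w != 0 | j <- iota 1 m]).+1%:R :> R.
  by rewrite longest_zero_runE natr1.
apply: coins_law.
  rewrite [X in measurable X](_ : _ = [set w |
    (fun s => (zero_run 0 s).+1%:R \in B) [seq X j w != 0 | j <- iota 1 m]]).
    exact: (measurable_bits m 1 (fun s => (zero_run 0 s).+1%:R \in B)).
  by apply/seteqP; split=> w; rewrite /= e inE.
move=> bs w sz /bits_eventP h; rewrite /preimage /= e inE.
suff -> : [seq X j w != 0 | j <- iota 1 m] = bs by [].
apply: (@eq_from_nth _ false); first by rewrite size_map size_iota.
rewrite size_map size_iota => j jm.
rewrite (nth_map 0%N) ?size_iota // nth_iota // h ?sz //.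
by case: nth; rewrite ?oner_eq0 ?eqxx.
Qed.
End Coins.

(** * The four avoidance classes *)

Lemma uniform_words_law (R : realType) (n : nat) (A : {set 'S_n})
    (ws : seq (seq nat)) (F : seq nat -> nat) (B : set R) :
  perm_eq (map (@word n) (enum A)) ws ->
  uniform_on R A ((fun s => (F (word s))%:R) @^-1` B) =
  ((count (fun w => (F w)%:R \in B) ws)%:R / (size ws)%:R)%:E.
Proof.
move=> pw; rewrite (uniform_on_law (f := F \o @word n) (vals := map F ws)).
  by rewrite count_map size_map.
by rewrite map_comp; exact: perm_map.
Qed.

Lemma uniform_bits_law (R : realType) (n m : nat) (A : {set 'S_n})
    (f : seq bool -> seq nat) (F : seq nat -> nat) (p : pred (seq bool)) (B : set R) :
  perm_eq (map (@word n) (enum A)) (map f (allbits m)) ->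
  (forall bs, size bs = m -> ((F (f bs))%:R \in B) = p bs) ->
  uniform_on R A ((fun s => (F (word s))%:R) @^-1` B) =
  ((count p (allbits m))%:R / (2 ^ m)%:R)%:E.
Proof.
move=> pw h; rewrite (uniform_words_law _ _ pw) count_map size_map size_allbits.
congr (_%:R / _)%:E; apply: eq_in_count => bs; rewrite mem_allbits => /eqP sz.
exact: h.
Qed.

Lemma Dset_pairs n :
  perm_eq [seq (val km.1, val km.2) | km <- enum (Dset n)] (pairs_below n).
Proof.
apply: uniq_perm; rewrite ?pairs_below_uniq //.
  rewrite map_inj_uniq ?enum_uniq // => -[k m] [k' m'] [/val_inj /= -> /val_inj /= ->] //.
move=> [k m]; rewrite mem_pairs_below; apply/mapP/idP.
  move=> [[k' m']]; rewrite mem_enum inE => h [-> ->]; move: h.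
  case/orP => [h|/eqP[-> ->]]; last by rewrite orbT.
  by have := ltn_ord m'; rewrite ltnS h => ->.
move=> h.
have [hk hm] : (k < n.+1)%N /\ (m < n.+1)%N by move: h; rewrite xpair_eqE; lia.
exists (Ordinal hk, Ordinal hm) => //; rewrite mem_enum inE /=.
case/orP: h => [/andP[-> _]//|/eqP[ek em]].
by apply/orP; right; apply/eqP; congr pair; apply: val_inj.
Qed.

Lemma rev_iotaS n : rev (iota 0 n.+1) = n :: rev (iota 0 n).
Proof. by rewrite -addn1 iotaD rev_cat. Qed.

Lemma pairwise_gtn_rev_iota n : pairwise gtn (n :: rev (iota 0 n)).
Proof. by rewrite -rev_iotaS pairwise_rev; exact: pairwise_ltn_iota. Qed.

Lemma perm_rev_iota n w :
  perm_eq w (n :: rev (iota 0 n)) = perm_eq w (iota 0 n.+1).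
Proof. by rewrite -rev_iotaS perm_sym perm_rev perm_sym. Qed.

Theorem theorem2p1 (R : realType) (n : nat) (n_ge3 : (3 <= n)%N) :
  (let S : {set 'S_n} :=
     avoiders n [set pattern [:: 1; 3; 2]%N; pattern [:: 3; 2; 1]%N]%SET in
   same_distribution (@uniform_on R _ S) (fun s => (LIS s)%:R)
     (@uniform_on R _ (Dset n)) (fun km => (Dfun km)%:R) /\
   (forall s : 'S_n, s \in S -> (LDS s <= 2)%N)) /\
  (let S : {set 'S_n} :=
     avoiders n [set pattern [:: 1; 3; 2]%N; pattern [:: 2; 3; 1]%N]%SET in
   same_distribution (@uniform_on R _ S) (fun s => (LIS s)%:R)
     (binomial_prob n.-1 (1 / 2)) (fun k => k%:R + 1) /\
   same_distribution (@uniform_on R _ S) (fun s => (LDS s)%:R)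
     (binomial_prob n.-1 (1 / 2)) (fun k => k%:R + 1)) /\
  (let S : {set 'S_n} :=
     avoiders n [set pattern [:: 1; 3; 2]%N; pattern [:: 1; 2; 3]%N]%SET in
   (forall (d : measure_display) (Omega : measurableType d)
      (P : probability Omega R) (X : nat -> {RV P >-> R}), fair_coins X ->
    same_distribution (@uniform_on R _ S) (fun s => (LDS s)%:R)
      P (fun w => Tvar n (fun i => X i w))) /\
   (forall s : 'S_n, s \in S -> (LIS s <= 2)%N)) /\
  (let S : {set 'S_n} :=
     avoiders n [set pattern [:: 1; 3; 2]%N; pattern [:: 2; 1; 3]%N]%SET in
   same_distribution (@uniform_on R _ S) (fun s => (LDS s)%:R)
     (binomial_prob n.-1 (1 / 2)) (fun k => k%:R + 1) /\
   (forall (d : measure_display) (Omega : measurableType d)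
      (P : probability Omega R) (X : nat -> {RV P >-> R}), fair_coins X ->
    same_distribution (@uniform_on R _ S) (fun s => (LIS s)%:R)
      P (fun w => (longest_zero_run n.-1 (fun i => X i w))%:R + 1))).
Proof.
have p132 : perm_eq [:: 1; 3; 2]%N (iota 1 3) by [].
have p321 : perm_eq [:: 3; 2; 1]%N (iota 1 3) by [].
have p231 : perm_eq [:: 2; 3; 1]%N (iota 1 3) by [].
have p123 : perm_eq [:: 1; 2; 3]%N (iota 1 3) by [].
have p213 : perm_eq [:: 2; 1; 3]%N (iota 1 3) by [].
have LISE : @LIS n = lis ltn \o @word n by apply/funext => s; exact: LIS_word.
have LDSE : @LDS n = lis gtn \o @word n by apply/funext => s; exact: LDS_word.
rewrite {}LISE {}LDSE /=; case: n n_ge3 => // n n_ge3 /=.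
have dl := pairwise_gtn_rev_iota n; have pl := perm_rev_iota n.
(* Words now have length [n.+1]: [n] is the largest letter and [l] lists the others in decreasing
   order, as the three bit encodings require. *)
set l := rev (iota 0 n) in dl pl.
have sl : size l = n by rewrite size_rev size_iota.
split; [|split; [|split]].
- split=> [B mB|s /(mem_avoiders p132 p321)[_]]; last exact: lis_avoids_decreasing.
  have pw := perm_words p132 p321 (rotation_words_uniq n.+1)
    (@perm_rotation_words n.+1) (@avoids_rotation_words n.+1)
    (@rotation_words_surj n.+1).
  rewrite (uniform_words_law _ _ pw).
  rewrite (uniform_on_law (f := @Dfun n.+1)
    (vals := map (lis ltn) (rotation_words n.+1))).
    by rewrite count_map size_map.
  rewrite lis_rotation_words.
  rewrite [X in perm_eq X _](_ : _ = map (fun km => n.+1 - minn (km.2 - km.1) km.1)%N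
    [seq (val km.1, val km.2) | km <- enum (Dset n.+1)]); last by rewrite -map_comp.
  exact/perm_map/Dset_pairs.
- have pw : perm_eq
      (map (@word n.+1) (enum (avoiders n.+1
         [set pattern [:: 1; 3; 2]%N; pattern [:: 2; 3; 1]%N]%SET)))
      (map (ends_word n l) (allbits (size l))).
    apply: (perm_words_bits p132 p231) => [bs|bs|w|bs1 bs2]; rewrite -?pl.
    + exact: ends_word_perm.
    + exact: avoids_ends_word.
    + exact: ends_word_surj.
    + exact: ends_word_inj.
  rewrite sl in pw; split=> B mB; rewrite binomial_bits.
    apply: (uniform_bits_law pw) => bs sz.
    by rewrite lis_ends_word // sz sl.
  rewrite -(count_allbits_negb n (fun k => k.+1%:R \in B)).
  apply: (uniform_bits_law pw) => bs sz.
  by rewrite lds_ends_word // sz sl.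
- have pw : perm_eq
      (map (@word n.+1) (enum (avoiders n.+1
         [set pattern [:: 1; 3; 2]%N; pattern [:: 1; 2; 3]%N]%SET)))
      (map (top2_word n l) (allbits (size l))).
    apply: (perm_words_bits p132 p123) => [bs|bs|w|bs1 bs2]; rewrite -?pl.
    + exact: top2_word_perm.
    + exact: avoids_top2_word.
    + exact: top2_word_surj.
    + exact: top2_word_inj.
  rewrite sl in pw; split=> [d Omega P X fX B mB|s /(mem_avoiders p132 p123)[_]];
    last exact: lis_avoids_increasing.
  rewrite (Tvar_law fX n_ge3 mB); apply: (uniform_bits_law pw) => bs sz.
  (* The length [n.+1] is rewritten as LDS plus the number of zero runs, so the real subtraction
     leaves LDS. *)
  have := lds_top2_word dl; rewrite sl => /(_ bs sz) <-.
  by rewrite natrD addrK.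
- have st : block_state [:: n] l.
    move: (dl); rewrite pairwise_cons => /andP[al dl'].
    by rewrite /block_state /= dl' allrel1l al.
  have pw : perm_eq
      (map (@word n.+1) (enum (avoiders n.+1
         [set pattern [:: 1; 3; 2]%N; pattern [:: 2; 1; 3]%N]%SET)))
      (map (block_word [:: n] l) (allbits (size l))).
    apply: (perm_words_bits p132 p213) => [bs|bs|w|bs1 bs2]; rewrite -?pl.
    + exact: block_word_perm.
    + exact: avoids_block_word.
    + move=> pw av1 av2.
      have nw : n \in w by rewrite (perm_mem pw) mem_head.
      (* The initial block is the largest letter alone, with [z] before it and [v] after it. *)
      case/splitPr: nw pw av1 av2 => z v pw av1 av2.
      apply: (@block_word_surj [:: n] l z v) => //.
      by move: pw; rewrite -cat1s perm_catCA cat1s perm_cons.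
    + exact: block_word_inj.
  rewrite sl in pw; split=> [B mB|d Omega P X fX B mB].
    rewrite binomial_bits; apply: (uniform_bits_law pw) => bs sz.
    by rewrite lds_block_word // sz sl.
  rewrite (longest_zero_run_law fX _ mB); apply: (uniform_bits_law pw) => bs sz.
  by rewrite lis_block_word // sz sl.
Qed.
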